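(* There is a polynomial-time $k$-approximation algorithm for $k$-row-sparse covering integer programs with multiplicity constraints. That is, there is a polynomial-time algorithm which, given nonnegative rational $A\in\mathbb{Q}_{\ge 0}^{m\times n}$ with at most $k$ nonzero entries in each row, $b\in\mathbb{Q}_{\ge0}^m$, $c\in\mathbb{Q}_{\ge0}^n$, and $d\in(\mathbb{Z}_{\ge0}\cup\{+\infty\})^n$, returns a feasible solution of $\min\{c\cdot x : Ax\ge b,\ 0\le x\le d,\ x\in\mathbb{Z}^n\}$ whose objective value is at most $k$ times the optimum.
   Context: A covering integer program (CIP) is an integer program $\{\min c\cdot x: Ax\ge b,\ 0\le x\le d,\ x \text{ integral}\}$ with $A,b,c,d$ nonnegative and rational; the constraints $x\le d$ are multiplicity constraints, entries of $d$ may be $+\infty$ and finite entries are integral. It is $k$-row-sparse ($k$-RS) if each row of $A$ has at most $k$ nonzero entries. A $k$-approximation algorithm for a covering problem returns a feasible solution of objective value at most $k$ times optimal (whenever the instance is feasible). *)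

(* Defs.v *)
From HB Require Import structures.
From mathcomp Require Import all_boot all_order all_algebra.

Set Implicit Arguments.
Unset Strict Implicit.
Unset Printing Implicit Defensive.

Import Order.TTheory GRing.Theory Num.Theory.

(* Polynomial time is measured on the random access machine of Aho, Hopcroft
   and Ullman under the logarithmic cost criterion, with structured control
   flow: an unbounded memory of natural numbers with indirect addressing, a
   read-once input tape and a write-once output tape. *)

Section RAM.
Local Open Scope nat_scope.

(* 0 has length 1, so every elementary step has positive cost. *)
Definition bitlen (n : nat) : nat := (trunc_log 2 n).+1.

Definition bitsize (s : seq nat) : nat := \sum_(a <- s) bitlen a.

Inductive binop := Add | Sub | Mul | Div.

(* Sub is truncated at 0, and Div by 0 returns 0. *)
Definition binop_eval (o : binop) : nat -> nat -> nat :=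
  match o with Add => addn | Sub => subn | Mul => muln | Div => divn end.

Inductive expr :=
  | Const of nat
  | Deref of expr
  | Op of binop & expr & expr.

Definition memory := nat -> nat.

Fixpoint eval (mu : memory) (e : expr) : nat :=
  match e with
  | Const a => a
  | Deref e1 => mu (eval mu e1)
  | Op o e1 e2 => binop_eval o (eval mu e1) (eval mu e2)
  end.

(* The total bit length of the values of all subexpressions, so that the
   addresses, the operands and the results are all paid for. *)
Fixpoint cost (mu : memory) (e : expr) : nat :=
  bitlen (eval mu e) +
  match e with
  | Const _ => 0
  | Deref e1 => cost mu e1
  | Op _ e1 e2 => cost mu e1 + cost mu e2
  end.

Inductive cmd :=
  | Skip
  | Store of expr & expr
  | Read of expr
  | Write of expr
  | Seq of cmd & cmd
  | If of expr & cmd & cmd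
  | While of expr & cmd.

Record state := State { mem : memory; inp : seq nat; outp : seq nat }.

Definition upd (mu : memory) (a v : nat) : memory :=
  fun a' => if a' == a then v else mu a'.

(* [exec P s s' t]: started in s, P halts in s' after a run of cost t.
   Tests succeed on nonzero values; reading an exhausted input gives 0. *)
Inductive exec : cmd -> state -> state -> nat -> Prop :=
  | exec_skip s : exec Skip s s 1
  | exec_store s e1 e2 :
      exec (Store e1 e2) s
        (State (upd (mem s) (eval (mem s) e1) (eval (mem s) e2))
               (inp s) (outp s))
        (cost (mem s) e1 + cost (mem s) e2)
  | exec_read s e :
      exec (Read e) s
        (State (upd (mem s) (eval (mem s) e) (head 0 (inp s)))
               (behead (inp s)) (outp s))
        (cost (mem s) e + bitlen (head 0 (inp s)))
  | exec_write s e :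
      exec (Write e) s
        (State (mem s) (inp s) (rcons (outp s) (eval (mem s) e)))
        (cost (mem s) e)
  | exec_seq c1 c2 s s1 s2 t1 t2 :
      exec c1 s s1 t1 -> exec c2 s1 s2 t2 ->
      exec (Seq c1 c2) s s2 (t1 + t2)
  | exec_if_true e c1 c2 s s' t :
      eval (mem s) e != 0 -> exec c1 s s' t ->
      exec (If e c1 c2) s s' (cost (mem s) e + t)
  | exec_if_false e c1 c2 s s' t :
      eval (mem s) e = 0 -> exec c2 s s' t ->
      exec (If e c1 c2) s s' (cost (mem s) e + t)
  | exec_while_true e c s s1 s2 t1 t2 :
      eval (mem s) e != 0 -> exec c s s1 t1 -> exec (While e c) s1 s2 t2 ->
      exec (While e c) s s2 (cost (mem s) e + t1 + t2)
  | exec_while_false e c s :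
      eval (mem s) e = 0 ->
      exec (While e c) s s (cost (mem s) e).

Definition run (P : cmd) (input output : seq nat) (t : nat) : Prop :=
  exists2 s : state,
    exec P (State (fun=> 0) input [::]) s t & outp s = output.

End RAM.

Section CIP.
Local Open Scope ring_scope.

(* [cip_d j = None] stands for an infinite multiplicity bound. *)
Record cip (m n : nat) := CIP {
  cip_A : 'M[rat]_(m, n);
  cip_b : 'cV[rat]_m;
  cip_c : 'rV[rat]_n;
  cip_d : 'I_n -> option nat;
  cip_A_ge0 : forall i j, 0 <= cip_A i j;
  cip_b_ge0 : forall i, 0 <= cip_b i 0;
  cip_c_ge0 : forall j, 0 <= cip_c 0 j
}.

Definition row_sparse (m n k : nat) (A : 'M[rat]_(m, n)) : Prop :=
  forall i, (#|[set j | A i j != 0%R]| <= k)%N.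

Definition feasible (m n : nat) (I : cip m n) (x : 'cV[int]_n) : Prop :=
  [/\ forall i, cip_b I i 0 <= (cip_A I *m map_mx intr x) i 0,
      forall j, 0 <= x j 0
    & forall j u, cip_d I j = Some u -> x j 0 <= u%:Z].

Definition objective (m n : nat) (I : cip m n) (x : 'cV[int]_n) : rat :=
  (cip_c I *m map_mx intr x) 0 0.

Definition optimal (m n : nat) (I : cip m n) (x : 'cV[int]_n) : Prop :=
  feasible I x /\ forall y, feasible I y -> objective I x <= objective I y.

Definition approx_solution (m n k : nat) (I : cip m n) (x : 'cV[int]_n) : Prop :=
  feasible I x /\
  exists2 y, optimal I y & objective I x <= k%:R * objective I y.

(* All encoded rationals are nonnegative, so dropping the sign loses nothing. *)
Definition encode_rat (q : rat) : seq nat := [:: `|numq q|%N; `|denq q|%N].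

Definition encode_bound (u : option nat) : seq nat :=
  if u is Some v then [:: 1; v]%N else [:: 0; 0]%N.

(* The dimensions, then A row by row, then b, c and d. *)
Definition encode_cip (m n : nat) (I : cip m n) : seq nat :=
  [:: m; n]
  ++ flatten [seq encode_rat (cip_A I i j) | i <- enum 'I_m, j <- enum 'I_n]
  ++ flatten [seq encode_rat (cip_b I i 0) | i <- enum 'I_m]
  ++ flatten [seq encode_rat (cip_c I 0 j) | j <- enum 'I_n]
  ++ flatten [seq encode_bound (cip_d I j) | j <- enum 'I_n].

(* Injective on nonnegative vectors, in particular on feasible solutions. *)
Definition encode_sol (n : nat) (x : 'cV[int]_n) : seq nat :=
  [seq `|x j 0%R|%N | j <- enum 'I_n].

End CIP.

(* Main.v *)
From mathcomp Require Import all_boot all_order all_algebra.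
From mathcomp Require Import zify.
From Stdlib Require Import Classical_Prop.
Require Import Defs.

(** Clearing denominators makes all data natural numbers. Every variable j has a
    budget y_j, initially 0, and stands at the level x_j = floor (y_j / c_j).
    While a row has a residual r = b - sum_j a_j x_j > 0, let beta be the least
    cost of lifting a single variable j of the row (within d_j) by
    ceil (r / (n a_j)), and add beta to the budget of every variable of the row.
    Every feasible z exceeds x by at least r / (n a_j) in some coordinate j of
    the row, hence c_j z_j - y_j >= beta there: the potential
    sum_j max (0, c_j z_j - y_j) drops by beta while the total budget grows by
    at most k beta, so that the final cost is at most k (c . z). The residual
    shrinks by a factor 1 - 1/n in each round, which makes the number of rounds
    polynomial. Free variables start at their upper bound, and an infinite bound
    is replaced by the sum of all scaled data. *)

Set Implicit Arguments.
Unset Strict Implicit.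
Unset Printing Implicit Defensive.

Import Order.TTheory GRing.Theory Num.Theory.
Local Open Scope nat_scope.

(** * Bit lengths of numbers and of results of operations *)

Lemma bitlen_leq (w v : nat) : 0 < w -> (bitlen v <= w) = (v < 2 ^ w).
Proof.
move=> w0; rewrite /bitlen; apply/idP/idP => [h|h].
  by apply: leq_trans (trunc_log_ltn v (isT : 1 < 2)) _; rewrite leq_exp2l.
case: v h => [|v] h; first by rewrite trunc_log0.
by rewrite -(ltn_exp2l _ _ (isT : 1 < 2)); apply: leq_ltn_trans h; exact: trunc_logP.
Qed.

Lemma bitlen_gt0 v : 0 < bitlen v. Proof. by []. Qed.

Lemma ltn_exp_bitlen v : v < 2 ^ bitlen v.
Proof. by rewrite -bitlen_leq. Qed.

Lemma leq_bitlen u v : u <= v -> bitlen u <= bitlen v.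
Proof. by move=> h; rewrite bitlen_leq //; apply: leq_ltn_trans h (ltn_exp_bitlen v). Qed.

(** For addition, both powers [2 ^ bitlen a] and [2 ^ bitlen b] are at least 2, so their product
    dominates their sum. One additive bound for all four operations lets [esize] be additive. *)
Lemma bitlen_binop o a b : bitlen (binop_eval o a b) <= bitlen a + bitlen b.
Proof.
case: o => /=.
- rewrite bitlen_leq // expnD.
  have := ltn_exp_bitlen a; have := ltn_exp_bitlen b.
  have : 2 <= 2 ^ bitlen a by rewrite -{1}(expn1 2) leq_exp2l.
  have : 2 <= 2 ^ bitlen b by rewrite -{1}(expn1 2) leq_exp2l.
  nia.
- by apply: leq_trans (leq_addr _ _); apply: leq_bitlen; exact: leq_subr.
- by rewrite bitlen_leq // expnD ltn_mul // ltn_exp_bitlen.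
- by apply: leq_trans (leq_addr _ _); apply: leq_bitlen; exact: leq_div.
Qed.

(** * A timed program logic *)

Inductive reg :=
  Rm | Rn | Rsize | Rt | Rscale | Rbig | Ri | Rj | Rres | Rbeta | Rtarget
| Rprice | Rflag | Num | Den | Cost | Bound | Budget.

Definition code (x : reg) : nat :=
  match x with
  | Rm => 0 | Rn => 1 | Rsize => 2 | Rt => 3 | Rscale => 4 | Rbig => 5 | Ri => 6
  | Rj => 7 | Rres => 8 | Rbeta => 9 | Rtarget => 10 | Rprice => 11
  | Rflag => 12 | Num => 13 | Den => 14 | Cost => 15 | Bound => 16
  | Budget => 17
  end.

Lemma code_lt x : code x < 32. Proof. by case: x. Qed.

(* Cell i of array x has address 32 i + code x, so that arrays of unknown
   length never overlap; a scalar is cell 0 of its array. *)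
Definition loc (x : reg) (e : expr) : expr :=
  Op Add (Op Mul (Const 32) e) (Const (code x)).
Definition get x e := Deref (loc x e).
Definition var x := get x (Const 0).

Inductive stm :=
  | Pass
  | Put of reg & expr & expr
  | Inp of reg & expr
  | Out of expr
  | Then of stm & stm
  | Cond of expr & stm & stm
  | Loop of expr & stm.

Fixpoint compile (p : stm) : cmd :=
  match p with
  | Pass => Skip
  | Put x i e => Store (loc x i) e
  | Inp x i => Read (loc x i)
  | Out e => Write e
  | Then p1 p2 => Seq (compile p1) (compile p2)
  | Cond e p1 p2 => If e (compile p1) (compile p2)
  | Loop e p1 => While e (compile p1)
  end.

(** Bounds the bit length of the value in units of [w]: a memory cell counts 1 whatever its address,
    and lengths add up under every operation. *)
Fixpoint esize (e : expr) : nat :=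
  match e with
  | Const a => bitlen a
  | Deref e1 => 1
  | Op _ e1 e2 => esize e1 + esize e2
  end.

Fixpoint ecost (e : expr) : nat :=
  esize e + match e with
  | Const a => 0
  | Deref e1 => ecost e1
  | Op _ e1 e2 => ecost e1 + ecost e2
  end.

(* The cost of p, in units of w, when every value has at most w bits and every
   loop makes at most w rounds. *)
Fixpoint stm_cost (w : nat) (p : stm) : nat :=
  match p with
  | Pass => 1
  | Put x i e => ecost (loc x i) + ecost e
  | Inp x i => ecost (loc x i) + 1
  | Out e => ecost e
  | Then p1 p2 => stm_cost w p1 + stm_cost w p2
  | Cond e p1 p2 => ecost e + (stm_cost w p1 + stm_cost w p2)
  | Loop e p1 => w.+1 * (ecost e + stm_cost w p1)
  end.

(** Each loop contributes a factor [w + 1], and the nesting depth is fixed by the program text. *)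
Lemma stm_cost_poly p : exists q : {poly nat}, forall w, q.[w]%R = stm_cost w p.
Proof.
elim: p => [|x i e|x i|e|p1 [q1 h1] p2 [q2 h2]|e p1 [q1 h1] p2 [q2 h2]|e p1 [q1 h1]].
- by exists 1%:P%R => w; rewrite hornerC.
- by exists (ecost (loc x i) + ecost e)%:P%R => w; rewrite hornerC.
- by exists (ecost (loc x i) + 1)%:P%R => w; rewrite hornerC.
- by exists (ecost e)%:P%R => w; rewrite hornerC.
- by exists (q1 + q2)%R => w; rewrite hornerD h1 h2.
- by exists ((ecost e)%:P + (q1 + q2))%R => w; rewrite !hornerD hornerC h1 h2.
- exists (('X + 1%:P) * ((ecost e)%:P + q1))%R => w.
  by rewrite hornerM !hornerD hornerX !hornerC h1 /= -addn1.
Qed.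

(** Codes are collected rather than registers, as [nat] comes with decidable equality. An array
    counts as assigned as soon as one of its cells may be. *)
Fixpoint assigned (p : stm) : seq nat :=
  match p with
  | Pass | Out _ => [::]
  | Put x _ _ | Inp x _ => [:: code x]
  | Then p1 p2 | Cond _ p1 p2 => assigned p1 ++ assigned p2
  | Loop _ p1 => assigned p1
  end.

Fixpoint reads (p : stm) : bool :=
  match p with
  | Pass | Out _ | Put _ _ _ => false
  | Inp _ _ => true
  | Then p1 p2 | Cond _ p1 p2 => reads p1 || reads p2
  | Loop _ p1 => reads p1
  end.

Fixpoint writes (p : stm) : bool :=
  match p with
  | Pass | Inp _ _ | Put _ _ _ => false
  | Out _ => true
  | Then p1 p2 | Cond _ p1 p2 => writes p1 || writes p2
  | Loop _ p1 => writes p1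
  end.

(** * States, updates and frames *)

Definition val_at (s : state) (x : reg) (i : nat) := mem s (32 * i + code x).
Definition ev (s : state) (e : expr) := eval (mem s) e.
Definition put (s : state) (x : reg) (i v : nat) :=
  State (upd (mem s) (32 * i + code x) v) (inp s) (outp s).
Definition pop (s : state) := State (mem s) (behead (inp s)) (outp s).
Definition emit (s : state) (v : nat) := State (mem s) (inp s) (rcons (outp s) v).

Arguments val_at : simpl never.
Arguments ev : simpl never.
Arguments put : simpl never.
Arguments pop : simpl never.
Arguments emit : simpl never.

(** Quotient and remainder modulo 32 recover index and register from an address, because codes stay
    below 32. *)
Lemma val_at_put s x i v y j :
  val_at (put s x i v) y j =
  if (code y == code x) && (j == i) then v else val_at s y j.
Proof.
rewrite /val_at /put /upd /=; have -> // :
  (32 * j + code y == 32 * i + code x) = ((code y == code x) && (j == i)).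
by have := code_lt x; have := code_lt y => ? ?; apply/eqP/andP => [h|[/eqP-> /eqP->]] //;
  split; apply/eqP; lia.
Qed.

Lemma val_at_pop s y j : val_at (pop s) y j = val_at s y j. Proof. by []. Qed.
Lemma val_at_emit s v y j : val_at (emit s v) y j = val_at s y j. Proof. by []. Qed.
Lemma inp_put s x i v : inp (put s x i v) = inp s. Proof. by []. Qed.
Lemma inp_pop s : inp (pop s) = behead (inp s). Proof. by []. Qed.
Lemma outp_put s x i v : outp (put s x i v) = outp s. Proof. by []. Qed.
Lemma outp_emit s v : outp (emit s v) = rcons (outp s) v. Proof. by []. Qed.
Definition val_atE :=
  (val_at_put, val_at_pop, val_at_emit, inp_put, inp_pop, outp_put, outp_emit).

Lemma ev_const s a : ev s (Const a) = a. Proof. by []. Qed.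
Lemma ev_get s x e : ev s (get x e) = val_at s x (ev s e). Proof. by []. Qed.
Lemma ev_var s x : ev s (var x) = val_at s x 0. Proof. by []. Qed.
Lemma ev_add s e1 e2 : ev s (Op Add e1 e2) = ev s e1 + ev s e2. Proof. by []. Qed.
Lemma ev_sub s e1 e2 : ev s (Op Sub e1 e2) = ev s e1 - ev s e2. Proof. by []. Qed.
Lemma ev_mul s e1 e2 : ev s (Op Mul e1 e2) = ev s e1 * ev s e2. Proof. by []. Qed.
Lemma ev_div s e1 e2 : ev s (Op Div e1 e2) = ev s e1 %/ ev s e2. Proof. by []. Qed.
Definition evE := (ev_var, ev_get, ev_const, ev_add, ev_sub, ev_mul, ev_div).

(** Every triple delivers this syntactic preservation, so that invariants only mention what the loop
    changes. *)
Definition frame (p : stm) (s s' : state) : Prop :=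
  [/\ forall x i, code x \notin assigned p -> val_at s' x i = val_at s x i,
      ~~ reads p -> inp s' = inp s & ~~ writes p -> outp s' = outp s].

Lemma frame_refl p s : frame p s s. Proof. by []. Qed.

Lemma frame_trans p s1 s2 s3 : frame p s1 s2 -> frame p s2 s3 -> frame p s1 s3.
Proof.
case=> h1 h2 h3 [g1 g2 g3]; split=> [x i hx|hx|hx].
- by rewrite g1 ?h1.
- by rewrite g2 ?h2.
- by rewrite g3 ?h3.
Qed.

Section TimedTriples.
Variable w : nat.
Hypothesis w_gt0 : 0 < w.

Definition bounded (s : state) : Prop :=
  (forall a, mem s a < 2 ^ w) /\ all (fun v => v < 2 ^ w) (inp s).

Lemma bitlen_ev s e : bounded s -> bitlen (ev s e) <= esize e * w.
Proof.
case=> hb _; elim: e => [a|e _|o e1 h1 e2 h2] /=.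
- by rewrite leq_pmulr.
- by rewrite mul1n bitlen_leq // hb.
- by apply: leq_trans (bitlen_binop _ _ _) _; rewrite mulnDl leq_add.
Qed.

Lemma cost_ev s e : bounded s -> cost (mem s) e <= ecost e * w.
Proof.
move=> hb; elim: e => [a|e he|o e1 h1 e2 h2] /=.
- by rewrite !addn0 leq_pmulr.
- by rewrite mulnDl leq_add // (@bitlen_ev s (Deref e)).
- by rewrite !mulnDl; do 2?apply: leq_add => //;
    have := @bitlen_ev s (Op o e1 e2) hb; rewrite /= mulnDl.
Qed.

(* An inductive wrapper, so that unification never unfolds a triple. *)
Variant wp (p : stm) (s : state) (Q : state -> Prop) : Prop :=
  Wp of bounded s -> exists s' t,
    [/\ exec (compile p) s s' t, t <= stm_cost w p * w, bounded s', frame p s s'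
      & Q s'].

Lemma wp_exec p s (Q : state -> Prop) : wp p s Q -> bounded s -> exists s' t,
    [/\ exec (compile p) s s' t, t <= stm_cost w p * w, bounded s', frame p s s'
      & Q s'].
Proof. by case. Qed.

Lemma wp_weaken p s (Q1 Q2 : state -> Prop) :
  wp p s Q1 -> (forall s', frame p s s' -> Q1 s' -> Q2 s') -> wp p s Q2.
Proof.
case=> h hQ; split=> /h[s' [t [h1 h2 h3 h4 h5]]].
by exists s', t; split=> //; apply: hQ.
Qed.

Lemma wp_pass s (Q : state -> Prop) : Q s -> wp Pass s Q.
Proof.
move=> hQ; split=> hb; exists s, 1; split=> //; first exact: exec_skip.
by rewrite /= mul1n.
Qed.

(** The only rule with a size condition, since values read from the input are already limited by
    [bounded]. Addresses and intermediate results may exceed [w] bits: [ecost] pays for them. *)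
Lemma wp_put s x i e (Q : state -> Prop) :
  ev s e < 2 ^ w -> Q (put s x (ev s i) (ev s e)) -> wp (Put x i e) s Q.
Proof.
move=> he hQ; split=> hb; exists (put s x (ev s i) (ev s e)).
exists (cost (mem s) (loc x i) + cost (mem s) e); split=> //.
- exact: exec_store.
- by rewrite [stm_cost _ _]/= mulnDl leq_add ?cost_ev.
- by case: hb => hm hi; split=> // a; rewrite /put /upd /=; case: ifP.
- by split=> // y j; rewrite /= inE => /negbTE h; rewrite val_at_put h.
Qed.

Lemma wp_inp s x i (Q : state -> Prop) :
  Q (put (pop s) x (ev s i) (head 0 (inp s))) -> wp (Inp x i) s Q.
Proof.
move=> hQ; split=> hb; exists (put (pop s) x (ev s i) (head 0 (inp s))).
exists (cost (mem s) (loc x i) + bitlen (head 0 (inp s))).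
have hh : head 0 (inp s) < 2 ^ w.
  by case: hb => _; case: (inp s) => [|v l] /=; rewrite ?expn_gt0 // => /andP[].
split=> //.
- exact: exec_read.
- by rewrite [stm_cost _ _]/= mulnDl leq_add ?cost_ev // mul1n bitlen_leq.
- case: hb => hm hi; split; first by move=> a; rewrite /put /upd /=; case: ifP.
  by move: hi; rewrite /=; case: (inp s) => [|v l] //= /andP[].
- by split=> // y j; rewrite /= inE => /negbTE h; rewrite val_at_put h.
Qed.

Lemma wp_out s e (Q : state -> Prop) : Q (emit s (ev s e)) -> wp (Out e) s Q.
Proof.
move=> hQ; split=> hb; exists (emit s (ev s e)), (cost (mem s) e); split=> //.
- exact: exec_write.
- by rewrite [stm_cost _ _]/= cost_ev.
Qed.

Lemma wp_then s p1 p2 (Q : state -> Prop) :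
  wp p1 s (fun s1 => frame p1 s s1 -> wp p2 s1 Q) -> wp (Then p1 p2) s Q.
Proof.
case=> h; split=> hb; have [s1 [t1 [e1 c1 b1 f1 h1]]] := h hb.
have [s2 [t2 [e2 c2 b2 f2 h2]]] := wp_exec (h1 f1) b1.
exists s2, (t1 + t2); split=> //.
- exact: exec_seq e1 e2.
- by rewrite /= mulnDl leq_add.
- case: f1 f2 => [f11 f12 f13] [f21 f22 f23]; split.
  + by move=> x i; rewrite /= mem_cat negb_or => /andP[? ?]; rewrite f21 ?f11.
  + by rewrite /= negb_or => /andP[? ?]; rewrite f22 ?f12.
  + by rewrite /= negb_or => /andP[? ?]; rewrite f23 ?f13.
Qed.

Lemma wp_cond s e p1 p2 (Q : state -> Prop) :
  (ev s e != 0 -> wp p1 s Q) -> (ev s e = 0 -> wp p2 s Q) ->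
  wp (Cond e p1 p2) s Q.
Proof.
move=> h1 h2; split=> hb; have hc := @cost_ev s e hb.
have [he|he] := eqVneq (ev s e) 0.
  have [s' [t [e1 c1 b1 [f1 f2 f3] q1]]] := wp_exec (h2 he) hb.
  exists s', (cost (mem s) e + t); split=> //.
  - exact: exec_if_false.
  - by rewrite /= !mulnDl; apply: leq_add => //; apply: leq_trans c1 (leq_addl _ _).
  - split=> [x i|h|h].
    + by rewrite /= mem_cat negb_or => /andP[_]; apply: f1.
    + by apply: f2; move: h; rewrite /= negb_or => /andP[].
    + by apply: f3; move: h; rewrite /= negb_or => /andP[].
have [s' [t [e1 c1 b1 [f1 f2 f3] q1]]] := wp_exec (h1 he) hb.
exists s', (cost (mem s) e + t); split=> //.
- exact: exec_if_true.
- by rewrite /= !mulnDl; apply: leq_add => //; apply: leq_trans c1 (leq_addr _ _).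
- split=> [x i|h|h].
  + by rewrite /= mem_cat negb_or => /andP[? _]; apply: f1.
  + by apply: f2; move: h; rewrite /= negb_or => /andP[].
  + by apply: f3; move: h; rewrite /= negb_or => /andP[].
Qed.

(** The index of [Inv] counts the rounds still allowed. It drops by one per round, and at index 0
    the test must fail. *)
Lemma wp_loop (Inv : nat -> state -> Prop) v s e p (Q : state -> Prop) :
  v <= w -> Inv v s ->
  (forall v1 s1, frame p s s1 -> Inv v1 s1 -> ev s1 e != 0 ->
     exists2 v2, v1 = v2.+1 & wp p s1 (Inv v2)) ->
  (forall v1 s1, frame p s s1 -> Inv v1 s1 -> ev s1 e = 0 -> Q s1) ->
  wp (Loop e p) s Q.
Proof.
move=> hv hI hstep hend; split=> hb.
(* The factor [v.+1] includes the final failing test. The frame from [s] is carried along because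
   [hstep] and [hend] ask for it. *)
suff loop s1 : Inv v s1 -> bounded s1 -> frame p s s1 -> exists s' t,
    [/\ exec (While e (compile p)) s1 s' t,
        t <= v.+1 * (ecost e + stm_cost w p) * w,
        bounded s', frame p s1 s' & Q s'].
  have [s' [t [h1 h2 h3 h4 h5]]] := loop s hI hb (frame_refl p s).
  exists s', t; split=> //; apply: leq_trans h2 _.
  by rewrite /= leq_mul2r leq_mul2r ltnS hv !orbT.
elim: v s1 {hI hb hv} => [|v IH] s1 hI hb hf.
  have [he|he] := eqVneq (ev s1 e) 0; last by have [] := hstep _ _ hf hI he.
  exists s1, (cost (mem s1) e); split=> //.
  - exact: exec_while_false.
  - by rewrite mul1n mulnDl (leq_trans (cost_ev e hb)) // leq_addr.
  - exact: hend hI he.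
have [he|he] := eqVneq (ev s1 e) 0.
  exists s1, (cost (mem s1) e); split=> //.
  - exact: exec_while_false.
  - rewrite mulSn mulnDl (leq_trans (cost_ev e hb)) //.
    by rewrite mulnDl -addnA leq_addr.
  - exact: hend hI he.
have [_ [<-] hp] := hstep _ _ hf hI he.
have [s2 [t2 [e2 c2 b2 f2 h2]]] := wp_exec hp hb.
have [s3 [t3 [e3 c3 b3 f3 h3]]] := IH s2 h2 b2 (frame_trans hf f2).
exists s3, (cost (mem s1) e + t2 + t3); split=> //; last exact: frame_trans f2 f3.
- exact: exec_while_true e2 e3.
- rewrite mulSn mulnDl; apply: leq_add => //.
  by rewrite mulnDl leq_add ?cost_ev.
Qed.

End TimedTriples.

Local Notation "x <- e" := (Put x (Const 0) e) (at level 70, no associativity).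
Local Notation "p ;; q" := (Then p q) (at level 75, right associativity).

Definition for_upto (x y : reg) (p : stm) : stm :=
  x <- Const 0 ;;
  Loop (Op Sub (var y) (var x)) (p ;; x <- Op Add (var x) (Const 1)).

(** The body changes neither counter nor limit, so the rounds left are the limit minus the counter.
    The invariant is re-established after the increment, hence on [put s2 x 0 t.+1]. *)
Lemma wp_for w (Inv : nat -> state -> Prop) x y p s (Q : state -> Prop) :
  0 < w -> code x \notin assigned p -> code y \notin code x :: assigned p ->
  val_at s y 0 <= w -> Inv 0 (put s x 0 0) ->
  (forall t s1, t < val_at s y 0 -> frame (for_upto x y p) s s1 ->
     val_at s1 x 0 = t -> Inv t s1 ->
     wp w p s1 (fun s2 => frame p s1 s2 -> Inv t.+1 (put s2 x 0 t.+1))) ->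
  (forall s1, frame (for_upto x y p) s s1 -> Inv (val_at s y 0) s1 -> Q s1) ->
  wp w (for_upto x y p) s Q.
Proof.
move=> w0 hx; rewrite inE negb_or => /andP[hyx hy] hN h0 hstep hend.
have hw : val_at s y 0 < 2 ^ w by apply: leq_ltn_trans hN _; apply: ltn_expl.
set N := val_at s y 0 in hN hstep hend hw *.
have fr s1 : frame (p ;; x <- Op Add (var x) (Const 1)) (put s x 0 0) s1 ->
    frame (for_upto x y p) s s1.
  case=> h1 h2 h3; split=> // z i; rewrite /= inE negb_or => /andP[hz1 hz2].
  by rewrite h1 // val_at_put (negbTE hz1).
apply: wp_then => //; apply: wp_put => //; rewrite ?evE ?expn_gt0 // => _.
apply: (@wp_loop w w0 (fun v s1 => [/\ v + val_at s1 x 0 = N & Inv (val_at s1 x 0) s1]) N).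
- by [].
- by rewrite val_at_put !eqxx addn0.
- move=> v s1 hf [hv hI]; rewrite !evE.
  have hyN : val_at s1 y 0 = N.
    case: hf => hf _ _; rewrite hf ?val_at_put ?(negbTE hyx) //.
    by rewrite /= mem_cat inE negb_or hy hyx.
  rewrite hyN subn_eq0 -ltnNge => hlt.
  exists v.-1; first by lia.
  apply: wp_then => //; apply: (wp_weaken (hstep _ _ hlt (fr _ hf) erefl hI)).
  move=> s2 hf2 hI2 _.
  have hx2 : val_at s2 x 0 = val_at s1 x 0 by case: hf2 => -> .
  apply: wp_put => //; rewrite !evE hx2 addn1 ?val_at_put ?eqxx /=.
    by apply: leq_ltn_trans hlt hw.
  by split; [lia|apply: hI2].
- move=> v s1 hf [hv hI]; rewrite !evE.
  have hyN : val_at s1 y 0 = N.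
    case: hf => hf _ _; rewrite hf ?val_at_put ?(negbTE hyx) //.
    by rewrite /= mem_cat inE negb_or hy hyx.
  rewrite hyN => h; apply: hend; first exact: fr.
  by have -> : N = val_at s1 x 0 by lia.
Qed.

(** * One round of the algorithm *)

Section Round.
Variables (n : nat) (a C D : nat -> nat) (b : nat).
Implicit Types (y z : nat -> nat) (r beta : nat).

Definition level y j := y j %/ C j.

(** Truncated, so that 0 means that the row is satisfied. *)
Definition residual y := b - \sum_(j < n) a j * level y j.

(* [(r + n * a j - 1) %/ (n * a j)] is the ceiling of [r / (n * a j)]. *)
Definition target y r j := level y j + (r + n * a j - 1) %/ (n * a j).

Definition price y r j := C j * target y r j - y j.

Definition candidate y r j := (0 < a j) && (target y r j <= D j).

(** Clipping at [C j * D j] keeps the level within [D j]. *)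
Definition raise y beta j :=
  if a j == 0 then y j else minn (y j + beta) (C j * D j).

Definition row_feasible z := b <= \sum_(j < n) a j * z j.

Lemma leq_target y r j x :
  0 < n -> 0 < a j -> r <= n * a j * (x - level y j) -> 0 < r ->
  target y r j <= x.
Proof.
move=> n0 a0 hr r0; rewrite /target.
have na0 : 0 < n * a j by rewrite muln_gt0 n0.
have hx : level y j < x by rewrite -subn_gt0; lia.
rewrite -(leq_subRL _ (ltnW hx)) -ltnS ltn_divLR // mulSn mulnC; lia.
Qed.

(** Rounding up: lifting [j] to its target covers at least a fraction 1/n of [r]. *)
Lemma ceil_target y r j :
  0 < n -> 0 < a j -> r <= n * (a j * (target y r j - level y j)).
Proof.
move=> n0 a0; rewrite /target addKn mulnA.
have na0 : 0 < n * a j by rewrite muln_gt0 n0.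
have := divn_eq (r + n * a j - 1) (n * a j).
have := ltn_pmod (r + n * a j - 1) na0.
by rewrite [X in _ = X + _ -> _]mulnC; lia.
Qed.

Lemma price_add y r j : 0 < C j -> 0 < n -> 0 < a j -> 0 < r ->
  y j < C j * target y r j.
Proof.
move=> C0 n0 a0 r0; have := ceil_target y r n0 a0.
have hl : y j < C j * (level y j).+1.
  by rewrite mulnC; apply: ltn_ceil.
move=> h; apply: leq_trans hl _; rewrite leq_mul2l; apply/orP; right.
by rewrite -subn_gt0; case: (target _ _ _ - _) h => //; lia.
Qed.

Lemma price_gt0 y r j : 0 < C j -> 0 < n -> 0 < a j -> 0 < r -> 0 < price y r j.
Proof. by move=> *; rewrite subn_gt0; apply: price_add. Qed.

Lemma leq_raise y beta j : y j <= C j * D j -> y j <= raise y beta j.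
Proof. by rewrite /raise; case: eqP => //; lia. Qed.

Lemma raise_leq y beta j : y j <= C j * D j -> raise y beta j <= C j * D j.
Proof. by rewrite /raise; case: eqP => //; lia. Qed.

(** The price of a candidate [j] lifts [j] to its target, which covers at least a fraction 1/n of
    the residual; no other level falls. *)
Lemma residual_raise y j :
  (forall i, i < n -> 0 < C i) -> (forall i, i < n -> y i <= C i * D i) ->
  j < n -> 0 < residual y -> candidate y (residual y) j ->
  n * residual (raise y (price y (residual y) j)) <= n.-1 * residual y.
Proof.
move=> hC hy hj r0 /andP[a0 ht]; set r := residual y in r0 ht *.
set y' := raise _ _; have n0 : 0 < n by apply: leq_ltn_trans hj.
have hl i : i < n -> level y i <= level y' i.
  by move=> hi; rewrite leq_div2r // leq_raise // hy.
have hj' : target y r j <= level y' j.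
  rewrite /level leq_divRL ?hC // /y' /raise (gtn_eqF a0).
  have -> : y j + price y r j = C j * target y r j.
    by rewrite /price subnKC // ltnW // price_add ?hC.
  by rewrite mulnC leq_min leqnn leq_mul2l ht orbT.
have hs : \sum_(i < n) a i * level y i + a j * (target y r j - level y j) <=
          \sum_(i < n) a i * level y' i.
  rewrite (bigD1 (Ordinal hj)) //= [X in _ <= X](bigD1 (Ordinal hj)) //=.
  have : \sum_(i < n | i != Ordinal hj) a i * level y i <=
    \sum_(i < n | i != Ordinal hj) a i * level y' i.
    by apply: leq_sum => i _; rewrite leq_mul2l hl ?orbT.
  have : a j * (target y r j - level y j) + a j * level y j <= a j * level y' j.
    by rewrite -mulnDr leq_mul2l subnK ?hj' ?orbT // leq_addr.
  by move=> h1 h2; rewrite addnAC leq_add // addnC.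
have hc := @ceil_target y r j n0 a0.
have h1 : residual y' <= r - a j * (target y r j - level y j).
  have hr : r = b - \sum_(i < n) a i * level y i by [].
  by rewrite [X in _ <= X - _]hr -subnDA leq_sub2l.
apply: (@leq_trans (n * (r - a j * (target y r j - level y j)))).
  by rewrite leq_mul2l h1 orbT.
by rewrite mulnBr -subn1 mulnBl mul1n; lia.
Qed.

(* A feasible z gains at least a fraction 1/n of the residual in one coordinate;
   that coordinate alone pays for the whole drop of the potential. *)
Lemma exists_candidate y z :
  row_feasible z -> (forall i, i < n -> z i <= D i) -> 0 < residual y ->
  exists j, [/\ j < n, candidate y (residual y) j & target y (residual y) j <= z j].
Proof.
move=> hz hD r0; set r := residual y.
have n0 : 0 < n.
  by move: hz r0; rewrite /row_feasible /residual; case: (n) => //; rewrite !big_ord0; lia.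
(* Averaging: if every term stayed below [r], the n gains would sum to less than [r], whereas
   feasibility of [z] makes them sum to at least [r]. *)
have [j hj] : exists j : 'I_n, r <= n * (a j * (z j - level y j)).
  apply/existsP; rewrite -[X in is_true X]negbK negb_exists.
  apply/negP => /forallP h.
  have : \sum_(j < n) (n * (a j * (z j - level y j))).+1 <= \sum_(j < n) r.
    by apply: leq_sum => j _; have := h j; rewrite -ltnNge.
  rewrite sum_nat_const card_ord.
  have -> : \sum_(j < n) (n * (a j * (z j - level y j))).+1 =
    n * \sum_(j < n) (a j * (z j - level y j)) + n.
    rewrite -[X in _ = _ + X]muln1 -[X in _ = _ + X * 1](card_ord n) -sum_nat_const.
    by rewrite big_distrr -big_split; apply: eq_bigr => j _ /=; rewrite addn1.
  have : \sum_(j < n) a j * z j <= \sum_(j < n) a j * level y j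
      + \sum_(j < n) (a j * (z j - level y j)).
    by rewrite -big_split leq_sum //= => j _; rewrite -mulnDr leq_mul2l; lia.
  move: hz r0; rewrite /row_feasible /r /residual.
  by set S := \sum_(j < n) (a j * (z j - level y j)); nia.
have a0 : 0 < a j by case: (a j) hj => //; rewrite mul0n muln0; lia.
have ht : target y r j <= z j by apply: leq_target => //; rewrite -mulnA.
by exists j; split=> //; rewrite /candidate a0 (leq_trans ht) // hD.
Qed.

(** In the coordinate just found, [y j + beta] is at most [C j * target], hence at most [C j * z j]:
    it is neither clipped nor truncated in the difference, which falls by exactly [beta]. The other
    terms do not grow. *)
Lemma potential_raise y z beta :
  row_feasible z -> (forall i, i < n -> z i <= D i) -> 0 < residual y ->
  (forall i, i < n -> y i <= C i * D i) ->
  (forall j, j < n -> candidate y (residual y) j -> beta <= price y (residual y) j) ->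
  \sum_(j < n) (C j * z j - raise y beta j) + beta <= \sum_(j < n) (C j * z j - y j).
Proof.
move=> hz hD r0 hy hb; have [j [hj hc ht]] := exists_candidate hz hD r0.
have hbeta := hb j hj hc; case/andP: hc => a0 _.
rewrite (bigD1 (Ordinal hj)) //= [X in _ <= X](bigD1 (Ordinal hj)) //=.
have : \sum_(i < n | i != Ordinal hj) (C i * z i - raise y beta i) <=
       \sum_(i < n | i != Ordinal hj) (C i * z i - y i).
  by apply: leq_sum => i _; rewrite leq_sub2l ?leq_raise ?hy.
have : C j * z j <= C j * D j by rewrite leq_mul2l hD ?orbT.
have : C j * target y (residual y) j <= C j * z j by rewrite leq_mul2l ht orbT.
have -> : raise y beta j = minn (y j + beta) (C j * D j).
  by rewrite /raise (gtn_eqF a0).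
move: hbeta; rewrite /price /=.
move: (C j * z j) (C j * D j) (C j * target y _ j) (y j) => cz cd ct yj.
by move: (\sum_(i < n | _) _) (\sum_(i < n | _) _); lia.
Qed.

Lemma sum_raise k y beta :
  #|[set j : 'I_n | a j != 0]| <= k ->
  \sum_(j < n) raise y beta j <= \sum_(j < n) y j + k * beta.
Proof.
move=> hk; apply: (@leq_trans (\sum_(j < n) (y j + (a j != 0) * beta))).
  by apply: leq_sum => j _; rewrite /raise; case: eqP; lia.
rewrite big_split /= leq_add2l -big_distrl leq_mul2r /=; apply/orP; right.
apply: leq_trans hk; rewrite -sum1_card big_mkcond [X in _ <= X]big_mkcond /=.
by apply: leq_sum => j _; rewrite inE; case: eqP.
Qed.

End Round.


(** * Geometric decay: how many rounds a row takes *)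

Lemma bernoulli m l : m ^ l.+1 + l.+1 * m ^ l <= m.+1 ^ l.+1.
Proof.
elim: l => [|l IH]; first by rewrite !expn1 expn0 muln1 addn1.
rewrite (expnS m.+1); apply: leq_trans (leq_mul (leqnn m.+1) IH).
by rewrite !expnS; nia.
Qed.

(** Bernoulli's inequality in the form (1 - 1/n)^n <= 1/2. *)
Lemma two_expn_pred n : 0 < n -> 2 * n.-1 ^ n <= n ^ n.
Proof.
case: n => // m _; rewrite [_.-1]/=; apply: leq_trans (bernoulli m m).
by rewrite mul2n -addnn leq_add2l expnS leq_mul2r leqnSn orbT.
Qed.

(** Every n rounds halve the residual, so n * l rounds bring a number below [2 ^ l] below 1. *)
Lemma ltn_expn_pred n r l :
  0 < n -> r < 2 ^ l -> r * n.-1 ^ (n * l) < n ^ (n * l).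
Proof.
move=> n0 hr; have h2 : 2 ^ l * n.-1 ^ (n * l) <= n ^ (n * l).
  rewrite !expnM -expnMn; case: l {hr} => // l.
  by rewrite leq_exp2r // two_expn_pred.
have [h0|hp] := posnP (n.-1 ^ (n * l)); first by rewrite h0 muln0 expn_gt0 n0.
by apply: leq_trans h2; rewrite ltn_pmul2r.
Qed.

(** * The program *)

(** Truncated subtraction yields the minimum. *)
Definition min_expr e1 e2 := Op Sub e1 (Op Sub e1 e2).

(** [Num] keeps the order of the input: the matrix row by row, then the right-hand sides, then the
    costs. *)
Definition coef_expr := get Num (Op Add (Op Mul (var Ri) (var Rn)) (var Rj)).
Definition rhs_expr := get Num (Op Add (Op Mul (var Rm) (var Rn)) (var Ri)).
Definition cost_expr :=
  get Num (Op Add (Op Add (Op Mul (var Rm) (var Rn)) (var Rm)) (var Rj)).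
Definition level_expr := Op Div (get Budget (var Rj)) (get Cost (var Rj)).
Definition step_expr := Op Mul (var Rn) coef_expr.

Definition load_prog :=
  for_upto Rt Rsize
    (Inp Num (var Rt) ;; Inp Den (var Rt) ;;
     Rscale <- Op Mul (var Rscale) (get Den (var Rt))).

Definition scale_prog :=
  for_upto Rt Rsize
    (Put Num (var Rt)
       (Op Div (Op Mul (get Num (var Rt)) (var Rscale)) (get Den (var Rt))) ;;
     Rbig <- Op Add (var Rbig) (get Num (var Rt))).

(** A free variable gets unit cost and a budget equal to its bound, so that its level is its bound
    from the start. *)
Definition bound_prog :=
  for_upto Rj Rn
    (Inp Rflag (Const 0) ;; Inp Bound (var Rj) ;;
     Cond (var Rflag) Pass (Put Bound (var Rj) (var Rbig)) ;;
     Cond cost_expr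
       (Put Cost (var Rj) cost_expr)
       (Put Cost (var Rj) (Const 1) ;;
        Put Budget (var Rj) (get Bound (var Rj)))).

Definition setup_prog :=
  Inp Rm (Const 0) ;; Inp Rn (Const 0) ;;
  Rsize <- Op Add (Op Add (Op Mul (var Rm) (var Rn)) (var Rm)) (var Rn) ;;
  Rscale <- Const 1 ;;
  load_prog ;; scale_prog ;; bound_prog.

Definition residual_prog :=
  Rres <- rhs_expr ;;
  for_upto Rj Rn (Rres <- Op Sub (var Rres) (Op Mul coef_expr level_expr)).

(** The test on [Bound + 1 - Rtarget] succeeds exactly when the target respects the bound; [Rbeta]
    is 0 until a candidate has been met. *)
Definition beta_prog :=
  Rbeta <- Const 0 ;;
  for_upto Rj Rn
    (Cond coef_expr
      (Rtarget <- Op Add level_expr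
         (Op Div (Op Sub (Op Add (var Rres) step_expr) (Const 1)) step_expr) ;;
       Cond (Op Sub (Op Add (get Bound (var Rj)) (Const 1)) (var Rtarget))
         (Rprice <- Op Sub (Op Mul (get Cost (var Rj)) (var Rtarget))
                           (get Budget (var Rj)) ;;
          Cond (var Rbeta)
            (Cond (Op Sub (var Rbeta) (var Rprice)) (Rbeta <- var Rprice) Pass)
            (Rbeta <- var Rprice))
         Pass)
      Pass).

Definition raise_prog :=
  for_upto Rj Rn
    (Cond coef_expr
      (Put Budget (var Rj)
         (min_expr (Op Add (get Budget (var Rj)) (var Rbeta))
                   (Op Mul (get Cost (var Rj)) (get Bound (var Rj)))))
      Pass).

(** Without a candidate no feasible solution exists; clearing [Rres] then ends the loop, so that the
    program also halts on infeasible instances. *)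
Definition round_prog :=
  residual_prog ;;
  Cond (var Rres)
    (beta_prog ;; Cond (var Rbeta) raise_prog (Rres <- Const 0))
    Pass.

(** One pass over the rows suffices because levels never fall. The initial 1 forces a first
    round. *)
Definition rows_prog :=
  for_upto Ri Rm (Rres <- Const 1 ;; Loop (var Rres) round_prog).

Definition output_prog := for_upto Rj Rn (Out level_expr).

Definition cip_prog := setup_prog ;; rows_prog ;; output_prog.

Lemma frame_val p s s' x i :
  frame p s s' -> code x \notin assigned p -> val_at s' x i = val_at s x i.
Proof. by case=> h _ _; apply: h. Qed.

Lemma frame_inp p s s' : frame p s s' -> ~~ reads p -> inp s' = inp s.
Proof. by case. Qed.

Lemma frame_outp p s s' : frame p s s' -> ~~ writes p -> outp s' = outp s.
Proof. by case. Qed.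

(** * Correctness of the program on scaled data *)

Section Program.
Variables (m n : nat) (num den fin ub : nat -> nat) (w : nat).

Definition size_data := m * n + m + n.
(** The product of the denominators is a common multiple whose bit length is at most the sum of
    theirs. *)
Definition scale := \prod_(t < size_data) den t.
Definition scaled t := num t * scale %/ den t.
Definition big := \sum_(t < size_data) scaled t.
Definition coef i j := scaled (i * n + j).
Definition rhs i := scaled (m * n + i).
Definition weight j := scaled (m * n + m + j).
(** Cost 1 for a free variable makes the division in [level] meaningful; as [budget0] starts it at
    its cap, it is never raised further. *)
Definition wcost j := if weight j == 0 then 1 else weight j.
(** [big] is at least every right-hand side and a nonzero scaled coefficient is at least 1, so [big]
    units of one variable satisfy each of its rows. *)
Definition cap j := if fin j == 0 then big else ub j.
Definition budget0 j := if weight j == 0 then cap j else 0.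

Definition scaled_feasible (z : nat -> nat) : Prop :=
  (forall i, i < m -> row_feasible n (coef i) (rhs i) z) /\
  (forall j, j < n -> z j <= cap j).

Lemma scaled_le_big t : t < size_data -> scaled t <= big.
Proof. by move=> ht; rewrite /big (bigD1 (Ordinal ht)) //= leq_addr. Qed.

Lemma coef_index i j : i < m -> j < n -> i * n + j < size_data.
Proof. by rewrite /size_data; nia. Qed.
Lemma rhs_index i : i < m -> m * n + i < size_data.
Proof. by rewrite /size_data; lia. Qed.
Lemma weight_index j : j < n -> m * n + m + j < size_data.
Proof. by rewrite /size_data; lia. Qed.

Lemma wcost_gt0 j : 0 < wcost j.
Proof. by rewrite /wcost; case: eqP => // /eqP; rewrite lt0n. Qed.

(** Demands on [w]: [wcost j * cap j] bounds budgets and prices, [cap j + big] bounds targets, and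
    [n * bitlen (rhs i) + 2] covers the rounds spent on row [i]. *)
Hypothesis w_gt0 : 0 < w.
Hypothesis size_le : size_data <= w.
Hypothesis den_gt0 : forall t, t < size_data -> 0 < den t.
Hypothesis scale_lt : scale < 2 ^ w.
Hypothesis big_lt : big < 2 ^ w.
Hypothesis wcost_cap_lt : forall j, j < n -> wcost j * cap j < 2 ^ w.
Hypothesis cap_big_lt : forall j, j < n -> cap j + big < 2 ^ w.
Hypothesis rounds_le : forall i, i < m -> n * bitlen (rhs i) + 2 <= w.

Lemma n_le : n <= w. Proof. by apply: leq_trans size_le; rewrite leq_addl. Qed.
Lemma m_le : m <= w.
Proof. by apply: leq_trans size_le; rewrite /size_data addnAC leq_addl. Qed.

Lemma cap_lt j : j < n -> cap j < 2 ^ w.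
Proof. by move=> hj; apply: leq_ltn_trans (cap_big_lt hj); rewrite leq_addr. Qed.

Definition data_input : seq nat :=
  m :: n :: flatten [seq [:: num t; den t] | t <- iota 0 size_data]
    ++ flatten [seq [:: fin j; ub j] | j <- iota 0 n].

Lemma iota_sub t k : t < k -> iota t (k - t) = t :: iota t.+1 (k - t.+1).
Proof. by move=> h; rewrite -[k - t]prednK ?subn_gt0 //= subnS. Qed.

Lemma load_spec s rest :
  val_at s Rsize 0 = size_data -> val_at s Rscale 0 = 1 ->
  inp s = flatten [seq [:: num t; den t] | t <- iota 0 size_data] ++ rest ->
  wp w load_prog s (fun s' =>
    [/\ forall t, t < size_data -> val_at s' Num t = num t /\ val_at s' Den t = den t,
        val_at s' Rscale 0 = scale & inp s' = rest]).
Proof.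
move=> hsz hsc hin; apply: (@wp_for w (fun t s1 =>
  [/\ forall i, i < t -> val_at s1 Num i = num i /\ val_at s1 Den i = den i,
      val_at s1 Rscale 0 = \prod_(i < t) den i
    & inp s1 = flatten [seq [:: num i; den i] | i <- iota t (size_data - t)] ++ rest])) => //.
- by rewrite hsz.
- by split=> //; rewrite ?val_atE ?big_ord0 // subn0.
- move=> t s1; rewrite hsz => ht hf ht1 [h1 h2 h3].
  rewrite (iota_sub ht) /= in h3.
  apply: wp_then => //; apply: wp_inp => // _.
  apply: wp_then => //; apply: wp_inp => // _.
  apply: wp_put => //; rewrite ?evE ?val_atE /= ?evE ?val_atE /= h3 ht1 eqxx h2 /=.
    have -> : \prod_(i < t) den i * den t = \prod_(i < t.+1) den i.
      by rewrite big_ord_recr.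
    (* A partial product is at most [scale], since the remaining denominators are positive. *)
    apply: leq_ltn_trans scale_lt.
    rewrite /scale -!(big_mkord predT den).
    rewrite [X in _ <= X](@big_cat_nat _ _ _ t.+1) //=.
    rewrite leq_pmulr // big_seq_cond prodn_cond_gt0 // => i.
    by rewrite mem_index_iota andbT => /andP[_ /den_gt0].
  move=> _; split.
  + move=> i; rewrite ltnS leq_eqVlt !val_atE /=.
    by case: eqP => [->|_] //= /h1.
  + by rewrite ?val_atE /= big_ord_recr.
  + by [].
- move=> s1 hf; rewrite hsz => -[h1 h2 h3]; split=> //.
  by rewrite h3 subnn.
Qed.

Lemma scale_spec s :
  val_at s Rsize 0 = size_data -> val_at s Rscale 0 = scale ->
  val_at s Rbig 0 = 0 ->
  (forall t, t < size_data -> val_at s Num t = num t /\ val_at s Den t = den t) ->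
  wp w scale_prog s (fun s' =>
    (forall t, t < size_data -> val_at s' Num t = scaled t) /\
    val_at s' Rbig 0 = big).
Proof.
move=> hsz hsc hb hd; apply: (@wp_for w (fun t s1 =>
  [/\ forall i, i < t -> val_at s1 Num i = scaled i,
      forall i, t <= i -> val_at s1 Num i = val_at s Num i
    & val_at s1 Rbig 0 = \sum_(i < t) scaled i])) => //.
- by rewrite hsz.
- by split=> // [i _|]; rewrite ?val_atE ?big_ord0.
- move=> t s1; rewrite hsz => ht hf ht1 [h1 h2 h3].
  have [hn hd1] := hd _ ht.
  have e1 : ev s1 (Op Div (Op Mul (get Num (var Rt)) (var Rscale)) (get Den (var Rt)))
      = scaled t.
    by rewrite !evE ht1 h2 // !(frame_val _ hf) // hsc hn hd1.
  apply: wp_then => //; apply: wp_put => //; rewrite e1.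
    exact: leq_ltn_trans (scaled_le_big ht) big_lt.
  move=> _; apply: wp_put => //; rewrite ?evE ?val_atE /= ?evE ?val_atE /= ht1 eqxx h3.
    have -> : \sum_(i < t) scaled i + scaled t = \sum_(i < t.+1) scaled i.
      by rewrite big_ord_recr.
    apply: leq_ltn_trans big_lt.
    rewrite /big -!(big_mkord predT scaled).
    by rewrite [X in _ <= X](@big_cat_nat _ _ _ t.+1) //= leq_addr.
  move=> _; split.
  + move=> i; rewrite ltnS leq_eqVlt !val_atE /=.
    by case: eqP => [->|_] //= /h1.
  + move=> i hi; rewrite !val_atE /=; case: eqP => [hit|_]; first by lia.
    by rewrite h2 // ltnW.
  + by rewrite ?val_atE /= big_ord_recr.
- by move=> s1 hf; rewrite hsz => -[h1 h2 h3]; split.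
Qed.

Lemma bound_spec s :
  val_at s Rn 0 = n -> val_at s Rm 0 = m -> val_at s Rbig 0 = big ->
  (forall t, t < size_data -> val_at s Num t = scaled t) ->
  (forall j, val_at s Budget j = 0) ->
  inp s = flatten [seq [:: fin j; ub j] | j <- iota 0 n] ->
  wp w bound_prog s (fun s' => forall j, j < n ->
    [/\ val_at s' Cost j = wcost j, val_at s' Bound j = cap j
      & val_at s' Budget j = budget0 j]).
Proof.
move=> hn hm hb hd hy hin; apply: (@wp_for w (fun t s1 =>
  [/\ forall j, j < t -> [/\ val_at s1 Cost j = wcost j, val_at s1 Bound j = cap j
      & val_at s1 Budget j = budget0 j],
      forall j, t <= j -> val_at s1 Budget j = 0
    & inp s1 = flatten [seq [:: fin j; ub j] | j <- iota t (n - t)]])) => //.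
- by rewrite hn n_le.
- by split=> //; [move=> j _; rewrite val_atE /= hy | rewrite subn0].
- move=> t s1; rewrite hn => ht hf ht1 [h1 h2 h3].
  rewrite (iota_sub ht) /= in h3.
  have hw : scaled (m * n + m + t) = weight t by [].
  have hwt := scaled_le_big (weight_index ht).
  apply: wp_then => //; apply: wp_inp => // _.
  apply: wp_then => //; apply: wp_inp => // _.
  rewrite !evE !val_atE /= h3 ht1 /=.
  set s2 := put _ _ _ _.
  apply: wp_then => //.
  apply: (@wp_weaken _ _ _ (fun s3 => val_at s3 Bound t = cap t /\
    forall j, j != t -> val_at s3 Bound j = val_at s1 Bound j)).
    apply: wp_cond => //; rewrite !evE /s2 !val_atE /= => hfin.
      apply: wp_pass => //; rewrite !val_atE /= eqxx /cap (negbTE hfin).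
      by split=> // j /negbTE hjt; rewrite !val_atE /= hjt.
    have eb : ev s2 (var Rbig) = big.
      by rewrite !evE /s2 !val_atE /= (frame_val _ hf) // hb.
    have ej : ev s2 (var Rj) = t by rewrite !evE /s2 !val_atE.
    apply: wp_put => //; rewrite eb // ej /s2; split=> [|j /negbTE hjt].
      by rewrite !val_atE /= eqxx /cap hfin.
    by rewrite !val_atE /= hjt.
  move=> s3 hf3 [hb3 hb3'] hf4.
  have hj3 : val_at s3 Rj 0 = t by rewrite (frame_val _ hf3) // /s2 !val_atE.
  have hc : ev s3 cost_expr = weight t.
    rewrite !evE hj3 !(frame_val _ hf3) // /s2 !val_atE /= !(frame_val _ hf) //.
    by rewrite hm hn hd // weight_index.
  have hcost j : val_at s3 Cost j = val_at s1 Cost j.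
    by rewrite (frame_val _ hf3) // /s2 !val_atE.
  have hbud j : val_at s3 Budget j = val_at s1 Budget j.
    by rewrite (frame_val _ hf3) // /s2 !val_atE.
  have hin3 : inp s3 = flatten [seq [:: fin j; ub j] | j <- iota t.+1 (n - t.+1)].
    by rewrite (frame_inp hf3) // /s2 !val_atE h3.
  apply: wp_cond => //; rewrite hc => hw0.
    apply: wp_put => //; rewrite hc ?evE ?hj3; first exact: leq_ltn_trans hwt big_lt.
    move=> _; split=> //.
    + move=> j; rewrite ltnS !val_atE /= /wcost /budget0.
      case: eqP => [->|/eqP hjt] /=; first by rewrite (negbTE hw0) hbud h2.
      rewrite leq_eqVlt (negbTE hjt) /= => /h1; rewrite /wcost /budget0 => -[<- <- <-].
      by rewrite hcost hbud hb3'.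
    + by move=> j hj; rewrite !val_atE /= hbud h2 // ltnW.
  apply: wp_then => //; apply: wp_put => //; rewrite ?evE ?hj3.
    by rewrite -{1}(expn0 2) ltn_exp2l.
  move=> _; apply: wp_put => //; rewrite !evE !val_atE /= hj3 hb3 ?cap_lt //.
  move=> _; split=> //.
  + move=> j; rewrite ltnS !val_atE /= /wcost /budget0.
    case: eqP => [->|/eqP hjt] /=; first by rewrite hw0.
    rewrite leq_eqVlt (negbTE hjt) /= => /h1; rewrite /wcost /budget0 => -[<- <- <-].
    by rewrite hcost hbud hb3'.
  + move=> j hj; rewrite !val_atE /=; case: eqP => [hjt|_] /=; first by lia.
    by rewrite hbud h2 // ltnW.
- by move=> s1 hf; rewrite hn => -[].
Qed.

Definition ready (s : state) : Prop :=
  [/\ val_at s Rm 0 = m, val_at s Rn 0 = n,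
      forall t, t < size_data -> val_at s Num t = scaled t,
      forall j, j < n -> val_at s Cost j = wcost j /\ val_at s Bound j = cap j
    & outp s = [::]].

Definition has_budget (s : state) (y : nat -> nat) : Prop :=
  forall j, j < n -> val_at s Budget j = y j.

Lemma ready_frame p s s' : frame p s s' ->
  all (fun c => c \notin assigned p)
    [:: code Rm; code Rn; code Num; code Cost; code Bound] ->
  ~~ writes p -> ready s -> ready s'.
Proof.
move=> hf; rewrite /= => /and5P[h1 h2 h3 h4 /andP[h5 _]] hw [g1 g2 g3 g4 g5].
split; rewrite ?(frame_val _ hf) // ?(frame_outp hf) //.
  by move=> t ht; rewrite (frame_val _ hf) // g3.
by move=> j hj; rewrite !(frame_val _ hf) //; apply: g4.
Qed.

Lemma setup_spec : wp w setup_prog (State (fun=> 0) data_input [::])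
  (fun s => ready s /\ has_budget s budget0).
Proof.
apply: wp_then => //; apply: wp_inp => // _.
apply: wp_then => //; apply: wp_inp => // _.
rewrite !evE /=; set s2 := put _ _ _ _.
have [hm hn] : val_at s2 Rm 0 = m /\ val_at s2 Rn 0 = n by rewrite /s2 !val_atE.
apply: wp_then => //; apply: wp_put => //; rewrite ?evE ?hm ?hn -/size_data.
  exact: leq_ltn_trans size_le (ltn_expl _ _).
move=> _; apply: wp_then => //; apply: wp_put => //; rewrite ?evE.
  by rewrite -{1}(expn0 2) ltn_exp2l.
move=> _; set s4 := put _ _ _ _.
apply: wp_then => //.
apply: (wp_weaken (@load_spec s4 (flatten [seq [:: fin j; ub j] | j <- iota 0 n]) _ _ _)).
- by rewrite /s4 !val_atE.
- by rewrite /s4 !val_atE.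
- by [].
move=> s5 hf5 [hd5 hsc5 hin5] _; apply: wp_then => //.
apply: (wp_weaken (@scale_spec s5 _ _ _ _)) => //.
- by rewrite (frame_val _ hf5) // /s4 !val_atE.
- by rewrite (frame_val _ hf5) // /s4 !val_atE.
move=> s6 hf6 [hd6 hb6] _.
have hm6 : val_at s6 Rm 0 = m.
  by rewrite (frame_val _ hf6) // (frame_val _ hf5) // /s4 !val_atE.
have hn6 : val_at s6 Rn 0 = n.
  by rewrite (frame_val _ hf6) // (frame_val _ hf5) // /s4 !val_atE.
apply: (wp_weaken (@bound_spec s6 _ _ _ _ _ _)) => //.
- by move=> j; rewrite (frame_val _ hf6) // (frame_val _ hf5) // /s4 !val_atE.
- by rewrite (frame_inp hf6).
move=> s7 hf7 h7; split; last by move=> j /h7[].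
split; rewrite ?(frame_val _ hf7) //.
- by move=> t ht; rewrite (frame_val _ hf7) ?hd6.
- by move=> j /h7[].
- by rewrite (frame_outp hf7) // (frame_outp hf6) // (frame_outp hf5).
Qed.

Lemma ev_coef s i j : ready s -> i < m -> j < n ->
  val_at s Ri 0 = i -> val_at s Rj 0 = j -> ev s coef_expr = coef i j.
Proof. by case=> _ hn hd _ _ hi hj ei ej; rewrite !evE ei ej hn hd // coef_index. Qed.

Lemma ev_level s y j : ready s -> has_budget s y -> j < n ->
  val_at s Rj 0 = j -> ev s level_expr = level wcost y j.
Proof. by case=> _ _ _ hc _ hy hj ej; rewrite !evE ej hy // (hc _ hj).1. Qed.

Lemma has_budget_frame p s s' y : frame p s s' -> code Budget \notin assigned p ->
  has_budget s y -> has_budget s' y.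
Proof. by move=> hf hp hy j hj; rewrite (frame_val _ hf) // hy. Qed.

Lemma ready_put s x i v : ready s ->
  code x \notin [:: code Rm; code Rn; code Num; code Cost; code Bound] ->
  ready (put s x i v).
Proof.
move=> hs hx; apply: (@ready_frame (Put x (Const i) (Const v)) s) => //.
  by split=> // y j; rewrite /= inE val_at_put => /negbTE->.
move: hx; rewrite /= !inE !negb_or => /and5P[]; rewrite ![code x == _]eq_sym.
by move=> -> -> -> -> ->.
Qed.

Notation res i y := (residual n (coef i) wcost (rhs i) y).

(** Subtracting the terms one by one with truncation agrees with one truncated subtraction of their
    sum. *)
Lemma residual_spec s i y : ready s -> i < m -> val_at s Ri 0 = i -> has_budget s y ->
  wp w residual_prog s (fun s' => val_at s' Rres 0 = res i y).
Proof.
move=> hr hi ei hy.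
have hb := scaled_le_big (rhs_index hi).
have eb : ev s rhs_expr = rhs i.
  by case: hr => hm hn hd _ _; rewrite !evE hm hn ei hd // rhs_index.
have hb' : rhs i < 2 ^ w by apply: leq_ltn_trans hb big_lt.
apply: wp_then => //; apply: wp_put => //; rewrite eb // evE => _.
have hr1 : ready (put s Rres 0 (rhs i)) by apply: ready_put.
have hn1 : val_at (put s Rres 0 (rhs i)) Rn 0 = n by case: hr1.
apply: (@wp_for w (fun t s1 =>
  val_at s1 Rres 0 = rhs i - \sum_(j < t) coef i j * level wcost y j)) => //.
- by rewrite hn1 n_le.
- by rewrite !val_atE /= big_ord0 subn0.
- move=> t s1; rewrite hn1 => ht hf ej h1.
  have hr2 : ready s1 by apply: ready_frame hr1; first exact: hf.
  have hy2 : has_budget s1 y.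
    by move=> j hj; rewrite (frame_val _ hf) // val_atE /= hy.
  have ei2 : val_at s1 Ri 0 = i by rewrite (frame_val _ hf) // val_atE.
  have e : ev s1 (Op Sub (var Rres) (Op Mul coef_expr level_expr)) =
      rhs i - \sum_(j < t.+1) coef i j * level wcost y j.
    rewrite ev_sub ev_mul (ev_coef hr2 hi ht ei2 ej) (ev_level hr2 hy2 ht ej).
    by rewrite ev_var h1 big_ord_recr subnDA.
  apply: wp_put => //; rewrite e.
  by apply: leq_ltn_trans (leq_subr _ _) hb'.
- by move=> s1 hf; rewrite hn1.
Qed.

Notation cand i y r := (candidate n (coef i) wcost cap y r).
Notation pri i y r := (price n (coef i) wcost y r).

(* 0 encodes the minimum over no candidate; every price is positive. *)
Definition is_min_price i y r t beta : Prop :=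
  if beta == 0 then forall j, j < t -> ~~ cand i y r j
  else (exists2 j, j < t & cand i y r j /\ beta = pri i y r j) /\
       (forall j, j < t -> cand i y r j -> beta <= pri i y r j).

Lemma is_min_price_skip i y r t beta :
  is_min_price i y r t beta -> ~~ cand i y r t -> is_min_price i y r t.+1 beta.
Proof.
rewrite /is_min_price; case: eqP => _ h ht.
  by move=> j; rewrite ltnS leq_eqVlt => /orP[/eqP->|/h].
case: h => -[j0 hj0 hc0] h; split; first by exists j0; rewrite // ltnW.
by move=> j; rewrite ltnS leq_eqVlt => /orP[/eqP->|/h] //; rewrite (negbTE ht).
Qed.

Lemma is_min_price_update i y r t beta :
  is_min_price i y r t beta -> cand i y r t -> 0 < pri i y r t ->
  is_min_price i y r t.+1
    (if beta == 0 then pri i y r t else minn beta (pri i y r t)).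
Proof.
rewrite /is_min_price => h hc p0; have [hb|hb] := eqVneq beta 0.
  rewrite hb eqxx in h; rewrite (gtn_eqF p0).
  split; first by exists t.
  by move=> j; rewrite ltnS leq_eqVlt => /orP[/eqP->|/h/negbTE->].
rewrite (negbTE hb) in h; case: h => -[j0 hj0 [hc0 e0]] h.
have -> : (minn beta (pri i y r t) == 0) = false by move: hb p0; lia.
split.
  have [hle|hlt] := leqP beta (pri i y r t).
    by exists j0; rewrite ?(minn_idPl hle) // ltnW.
  by exists t; rewrite // (minn_idPr (ltnW hlt)).
move=> j; rewrite ltnS leq_eqVlt => /orP[/eqP-> _|hj /h hc']; first exact: geq_minr.
by rewrite geq_min hc'.
Qed.

Lemma beta_spec s i y r : ready s -> i < m -> val_at s Ri 0 = i -> has_budget s y ->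
  (forall j, j < n -> y j <= wcost j * cap j) ->
  val_at s Rres 0 = r -> 0 < r -> r <= rhs i ->
  wp w beta_prog s (fun s' => is_min_price i y r n (val_at s' Rbeta 0)).
Proof.
move=> hr hi ei hy hyc er r0 hrb.
have hb := scaled_le_big (rhs_index hi).
apply: wp_then => //; apply: wp_put => //; rewrite ?evE ?expn_gt0 // => _.
have hr1 : ready (put s Rbeta 0 0) by apply: ready_put.
have hn1 : val_at (put s Rbeta 0 0) Rn 0 = n by case: hr1.
apply: (@wp_for w (fun t s1 => is_min_price i y r t (val_at s1 Rbeta 0))) => //.
- by rewrite hn1 n_le.
- move=> t s1; rewrite hn1 => ht hf ej h1.
  have hr2 : ready s1 by apply: ready_frame hr1; first exact: hf.
  have hy2 : has_budget s1 y.
    by move=> j hj; rewrite (frame_val _ hf) // val_atE /= hy.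
  have ei2 : val_at s1 Ri 0 = i by rewrite (frame_val _ hf) // val_atE.
  have er2 : val_at s1 Rres 0 = r by rewrite (frame_val _ hf) // val_atE.
  have n0 : 0 < n by apply: leq_ltn_trans ht.
  have [hC2 hD2] : val_at s1 Cost t = wcost t /\ val_at s1 Bound t = cap t.
    by case: hr2 => _ _ _ h _; apply: h.
  have hn2 : val_at s1 Rn 0 = n by case: hr2.
  apply: wp_cond => //; rewrite (ev_coef hr2 hi ht ei2 ej) => ha; last first.
    apply: wp_pass => // _; rewrite val_atE /=.
    by apply: is_min_price_skip; rewrite // /candidate ha.
  have a0 : 0 < coef i t by rewrite lt0n.
  set q := target n (coef i) wcost y r t.
  have eq1 : ev s1 (Op Add level_expr
         (Op Div (Op Sub (Op Add (var Rres) step_expr) (Const 1)) step_expr)) = q.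
    rewrite ev_add (ev_level hr2 hy2 ht ej) ev_div ev_sub ev_add ev_const ev_mul.
    by rewrite (ev_coef hr2 hi ht ei2 ej) !ev_var er2 hn2.
  (* The target is stored before it is compared with the bound. Its level part is at most the cap,
     and the rounded quotient is at most [r]. *)
  have hq : q <= cap t + r.
    rewrite /q /target leq_add //.
      by rewrite /level (leq_trans (leq_div2r _ (hyc t ht))) // mulKn // wcost_gt0.
    have na0 : 0 < n * coef i t by rewrite muln_gt0 n0.
    by rewrite -ltnS ltn_divLR // mulSn; nia.
  apply: wp_then => //; apply: wp_put => //; rewrite eq1.
    apply: leq_ltn_trans hq _; apply: leq_ltn_trans (cap_big_lt ht).
    by rewrite leq_add2l (leq_trans hrb).
  rewrite evE => _; set s2 := put s1 _ _ _.
  apply: wp_cond => //; rewrite !evE /s2 !val_atE /= ej hD2 addn1 => hcap; last first.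
    apply: wp_pass => // _; rewrite !val_atE /=; apply: is_min_price_skip => //.
    by rewrite /candidate a0 -/q /= -ltnNge; move: hcap; lia.
  have hc : cand i y r t by rewrite /candidate a0 -/q /=; move: hcap; lia.
  have p0 : 0 < pri i y r t by rewrite price_gt0 // wcost_gt0.
  have ep : ev s2 (Op Sub (Op Mul (get Cost (var Rj)) (var Rtarget))
                           (get Budget (var Rj))) = pri i y r t.
    by rewrite !evE /s2 !val_atE /= ej hC2 hy2.
  (* Only candidates are priced, and their targets are at most the cap. *)
  have hp : pri i y r t < 2 ^ w.
    apply: leq_ltn_trans (wcost_cap_lt ht); apply: leq_trans (leq_subr _ _) _.
    by rewrite leq_mul2l; case/andP: hc => _ ->; rewrite orbT.
  have h3 := is_min_price_update h1 hc p0.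
  apply: wp_then => //; apply: wp_put => //; rewrite ep // evE => _.
  apply: wp_cond => //; rewrite !evE /s2 !val_atE /= => hb0; last first.
    apply: wp_put => //; rewrite !evE !val_atE //= => _.
    by move: h3; rewrite hb0 eqxx ?val_atE.
  rewrite (negbTE hb0) in h3.
  apply: wp_cond => //; rewrite !evE !val_atE /= => hlt.
    apply: wp_put => //; rewrite !evE !val_atE //= => _; rewrite ?val_atE /=.
    by move: h3; rewrite (minn_idPr _) //; move: hlt; lia.
  apply: wp_pass => // _; rewrite !val_atE /=.
  by move: h3; rewrite (minn_idPl _) //; move: hlt; lia.
- by move=> s1 hf; rewrite hn1.
Qed.

Lemma raise_spec s i y beta : ready s -> i < m -> val_at s Ri 0 = i ->
  has_budget s y -> (forall j, j < n -> y j <= wcost j * cap j) ->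
  val_at s Rbeta 0 = beta ->
  wp w raise_prog s (fun s' => has_budget s' (raise (coef i) wcost cap y beta)).
Proof.
move=> hr hi ei hy hyc eb.
have hn1 : val_at s Rn 0 = n by case: hr.
apply: (@wp_for w (fun t s1 => forall j, j < n -> val_at s1 Budget j =
  if j < t then raise (coef i) wcost cap y beta j else y j)) => //.
- by rewrite hn1 n_le.
- by move=> j hj; rewrite !val_atE /= hy.
- move=> t s1; rewrite hn1 => ht hf ej h1.
  have hr2 : ready s1 by apply: ready_frame hr; first exact: hf.
  have ei2 : val_at s1 Ri 0 = i by rewrite (frame_val _ hf).
  have eb2 : val_at s1 Rbeta 0 = beta by rewrite (frame_val _ hf).
  have [hC2 hD2] : val_at s1 Cost t = wcost t /\ val_at s1 Bound t = cap t.
    by case: hr2 => _ _ _ h _; apply: h.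
  apply: wp_cond => //; rewrite (ev_coef hr2 hi ht ei2 ej) => ha; last first.
    apply: wp_pass => // _ j hj; rewrite val_atE /= h1 // ltnS [j <= t]leq_eqVlt.
    by have [->|_] := eqVneq j t; rewrite //= ltnn /raise ha.
  have e : ev s1 (min_expr (Op Add (get Budget (var Rj)) (var Rbeta))
                   (Op Mul (get Cost (var Rj)) (get Bound (var Rj)))) =
      raise (coef i) wcost cap y beta t.
    rewrite !evE ej h1 // ltnn eb2 hC2 hD2 /raise (negbTE ha); lia.
  apply: wp_put => //; rewrite e.
    by apply: leq_ltn_trans (wcost_cap_lt ht); apply: raise_leq; apply: hyc.
  rewrite evE ej => _ j hj; rewrite !val_atE /= ltnS [j <= t]leq_eqVlt.
  by have [->|_] := eqVneq j t; rewrite //= h1.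
- by move=> s1 hf; rewrite hn1 => h j hj; rewrite h // hj.
Qed.

(** The last clause is the amortised bound: total budget plus k times the potential never exceeds
    its initial value. It holds for all [k] and [z] at once, as the program knows neither. *)
Definition good (y : nat -> nat) : Prop :=
  [/\ forall j, j < n -> budget0 j <= y j,
      forall j, j < n -> y j <= wcost j * cap j
    & forall k z,
      (forall i, i < m -> #|[set j : 'I_n | coef i j != 0]| <= k) ->
      scaled_feasible z ->
      \sum_(j < n) y j + k * \sum_(j < n) (wcost j * z j - y j) <=
      \sum_(j < n) budget0 j + k * \sum_(j < n) (wcost j * z j - budget0 j)].

Lemma good_budget0 : good budget0.
Proof.
split=> // j hj; rewrite /budget0; case: eqP => // _.
by rewrite leq_pmull // wcost_gt0.
Qed.

(** The total budget grows by at most [k * beta], while k times the potential falls by at least as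
    much. *)
Lemma good_raise i y beta : i < m -> good y -> 0 < res i y -> beta != 0 ->
  is_min_price i y (res i y) n beta -> good (raise (coef i) wcost cap y beta).
Proof.
move=> hi [hy0 hyc hpot] r0 b0; rewrite /is_min_price (negbTE b0) => -[_ hmin].
split=> [j hj|j hj|k z hk hz].
- by apply: leq_trans (hy0 _ hj) _; apply: leq_raise; apply: hyc.
- by apply: raise_leq; apply: hyc.
- apply: leq_trans (hpot k z hk hz).
  have h1 := sum_raise wcost cap y beta (hk i hi).
  have h2 := potential_raise (hz.1 i hi) hz.2 r0 hyc hmin.
  apply: leq_trans (leq_add h1 (leqnn _)) _.
  by rewrite -addnA leq_add2l -mulnDr leq_mul2l addnC h2 orbT.
Qed.

(** Keeps the rows already treated satisfied while later rows raise budgets. *)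
Lemma residual_anti i y y' : (forall j, j < n -> y j <= y' j) -> res i y' <= res i y.
Proof.
move=> h; apply: leq_sub2l; apply: leq_sum => j _.
by rewrite leq_mul2l leq_div2r ?orbT // h.
Qed.

Lemma row_spec s i y : ready s -> i < m -> val_at s Ri 0 = i -> has_budget s y ->
  good y ->
  wp w (Rres <- Const 1 ;; Loop (var Rres) round_prog) s (fun s' => exists y',
    [/\ has_budget s' y', good y', forall j, j < n -> y j <= y' j
      & forall z, scaled_feasible z -> res i y' = 0]).
Proof.
move=> hr hi ei hy hg.
apply: wp_then => //; apply: wp_put => //; rewrite ?evE.
  by rewrite -{1}(expn0 2) ltn_exp2l.
move=> _; have hr1 : ready (put s Rres 0 1) by apply: ready_put.
(* Each round shrinks the residual by (n - 1)/n and lowers [v'] by one, preserving the inequality;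
   at [v' = 0] it reads residual < 1. The tested [Rres] predates the last raise, so one more round
   is needed to notice this: hence [v = v'.+1]. *)
apply: (@wp_loop w w_gt0 (fun v s1 => exists y1,
  [/\ has_budget s1 y1, good y1, forall j, j < n -> y j <= y1 j
    & if val_at s1 Rres 0 == 0 then forall z, scaled_feasible z -> res i y1 = 0
      else exists2 v', v = v'.+1 & 0 < n -> res i y1 * n.-1 ^ v' < n ^ v'])
  (n * bitlen (rhs i)).+1).
- by have := rounds_le hi; lia.
- exists y; split=> //; first by move=> j hj; rewrite val_atE hy.
  rewrite val_atE /=; exists (n * bitlen (rhs i)) => // n0.
  apply: ltn_expn_pred => //; apply: leq_ltn_trans (ltn_exp_bitlen _).
  exact: leq_subr.
- move=> v s1 hf [y1 [hy1 hg1 hyy hv]]; rewrite evE => hres.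
  rewrite (negbTE hres) in hv; case: hv => v' ev' hv; exists v' => //.
  have [hg10 hg1c _] := hg1.
  have hr2 : ready s1 by apply: ready_frame hr1; first exact: hf.
  have ei1 : val_at s1 Ri 0 = i by rewrite (frame_val _ hf) // val_atE.
  apply: wp_then => //; apply: (wp_weaken (residual_spec hr2 hi ei1 hy1)).
  move=> s2 hf2 hres2 _.
  have hr3 : ready s2 by apply: ready_frame hr2; first exact: hf2.
  have ei2 : val_at s2 Ri 0 = i by rewrite (frame_val _ hf2).
  have hy2 : has_budget s2 y1 by apply: has_budget_frame hy1; first exact: hf2.
  apply: wp_cond => //; rewrite evE hres2 => r0; last first.
    by apply: wp_pass => //; exists y1; split=> //; rewrite hres2 r0.
  rewrite -lt0n in r0; apply: wp_then => //.
  apply: (wp_weaken (beta_spec hr3 hi ei2 hy2 hg1c hres2 r0 (leq_subr _ _))).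
  move=> s3 hf3 hmin _.
  have hr4 : ready s3 by apply: ready_frame hr3; first exact: hf3.
  have ei3 : val_at s3 Ri 0 = i by rewrite (frame_val _ hf3).
  have hy3 : has_budget s3 y1 by apply: has_budget_frame hy2; first exact: hf3.
  have hres3 : val_at s3 Rres 0 = res i y1 by rewrite (frame_val _ hf3).
  apply: wp_cond => //; rewrite evE => hb; last first.
    apply: wp_put => //; rewrite ?evE ?expn_gt0 //.
    exists y1; split=> //; first by move=> j hj; rewrite val_atE /= hy3.
    rewrite val_atE /= => z [hz hzc].
    (* A feasible [z] would provide a candidate, but none was found. *)
    have [j [hj hc _]] := exists_candidate (C := wcost) (hz i hi) hzc r0.
    by move: hmin; rewrite /is_min_price hb eqxx => /(_ _ hj); rewrite hc.
  apply: (wp_weaken (raise_spec hr4 hi ei3 hy3 hg1c erefl)) => s4 hf4 hy4.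
  exists (raise (coef i) wcost cap y1 (val_at s3 Rbeta 0)); split=> //.
  + exact: good_raise hmin.
  + by move=> j hj; apply: leq_trans (hyy _ hj) _; apply: leq_raise; apply: hg1c.
  + rewrite (frame_val _ hf4) // hres3 (gtn_eqF r0).
    move: hmin; rewrite /is_min_price (negbTE hb) => -[[j hj [hc ->]] _].
    have n0 : 0 < n by apply: leq_ltn_trans hj.
    (* At exponent 0 the residual would be 0, so a raise happens only with a round to spare. *)
    case: v' hv {ev'} => [|v'] hv; first by move: (hv n0) r0; rewrite !expn0; lia.
    exists v' => // _.
    have h := residual_raise (fun i _ => wcost_gt0 i) hg1c hj r0 hc.
    have {}hv := hv n0; rewrite !expnS in hv.
    (* After multiplication by n, the new residual is replaced by n - 1 times the old one, which
       supplies the missing factor of the old inequality. *)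
    rewrite -(ltn_pmul2l n0); apply: leq_ltn_trans hv.
    by rewrite mulnA [X in _ <= X]mulnCA mulnA leq_mul2r h orbT.
- move=> v s1 hf [y1 [hy1 hg1 hyy hv]]; rewrite evE => h0; rewrite h0 eqxx in hv.
  by exists y1.
Qed.

(** The residuals are claimed to vanish only if some feasible [z] exists, since the program also
    halts on infeasible input. *)
Definition solved (y : nat -> nat) : Prop :=
  good y /\ forall z, scaled_feasible z -> forall i, i < m -> res i y = 0.

Lemma cip_prog_spec : wp w cip_prog (State (fun=> 0) data_input [::])
  (fun s => exists2 y, solved y & outp s = mkseq (level wcost y) n).
Proof.
apply: wp_then => //; apply: (wp_weaken setup_spec) => s1 _ [hr1 hy1] _.
have hm1 : val_at s1 Rm 0 = m by case: hr1.
apply: wp_then => //; apply: (@wp_weaken _ _ _ (fun s2 => ready s2 /\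
  exists2 y, solved y & has_budget s2 y)).
  apply: (@wp_for w (fun t s2 => exists y, [/\ good y, has_budget s2 y &
    forall z, scaled_feasible z -> forall i, i < t -> res i y = 0])) => //.
  - by rewrite hm1 m_le.
  - exists budget0; split=> //; first exact: good_budget0.
    by move=> j hj; rewrite val_atE /= hy1.
  - move=> t s2; rewrite hm1 => ht hf et [y [hg hy hz]].
    have hr2 : ready s2 by apply: ready_frame hr1; first exact: hf.
    apply: (wp_weaken (row_spec hr2 ht et hy hg)) => s3 hf3 [y' [hy' hg' hle hz']] _.
    exists y'; split=> //; first by move=> j hj; rewrite val_atE /= hy'.
    move=> z hzf i; rewrite ltnS leq_eqVlt => /orP[/eqP->|hi]; first exact: hz' hzf.
    by apply/eqP; rewrite -leqn0 -(hz z hzf i hi) residual_anti.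
  - move=> s2 hf; rewrite hm1 => -[y [hg hy hz]]; split.
      by apply: ready_frame hr1; first exact: hf.
    by exists y.
move=> s2 _ [hr2 [y hs hy2]] _.
have hn2 : val_at s2 Rn 0 = n by case: hr2.
apply: (@wp_for w (fun t s3 => outp s3 = mkseq (level wcost y) t)) => //.
- by rewrite hn2 n_le.
- by case: hr2.
- move=> t s3; rewrite hn2 => ht hf et ho.
  have [hC hY] : val_at s3 Cost t = wcost t /\ val_at s3 Budget t = y t.
    rewrite !(frame_val _ hf) // hy2 //; split=> //.
    by case: hr2 => _ _ _ h _; case: (h _ ht).
  apply: wp_out => //; rewrite !evE et hC hY => _.
  by rewrite !val_atE ho /mkseq -addn1 iotaD map_cat cats1.
- by move=> s3 hf; rewrite hn2 => ho; exists y.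
Qed.

End Program.

(** * From instances to scaled instances *)

(** Descent on the values of [f]; the predicate is arbitrary, so whether a smaller value exists is
    decided classically. *)
Lemma exists_argmin (T : Type) (P : T -> Prop) (f : T -> nat) :
  (exists x, P x) -> exists2 x, P x & forall y, P y -> f x <= f y.
Proof.
case=> x; have [k] := ubnP (f x); elim: k x => // k IH x hx Px.
have [[y [Py hy]]|h] := classic (exists y, P y /\ f y < f x).
  by apply: (IH y) => //; apply: leq_trans hy _.
exists x => // y Py; rewrite leqNgt; apply/negP => hy; apply: h.
by exists y.
Qed.

Lemma bitsize_cat s1 s2 : bitsize (s1 ++ s2) = bitsize s1 + bitsize s2.
Proof. by rewrite /bitsize big_cat. Qed.

Lemma bitlen_leq_bitsize s v : v \in s -> bitlen v <= bitsize s.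
Proof. by move=> hv; rewrite /bitsize (big_rem v) //= leq_addr. Qed.

(** Row-major indexing. Membership is [List.In] because [T] carries no decidable equality. *)
Lemma nth_flatten_uniform (T : Type) (x0 : T) (n : nat) (ss : seq (seq T)) i j :
  (forall s, List.In s ss -> size s = n) -> i < size ss -> j < n ->
  nth x0 (flatten ss) (i * n + j) = nth x0 (nth [::] ss i) j.
Proof.
elim: ss i => // s ss IH [|i] hs hi hj /=; rewrite nth_cat hs; [|by left| |by left].
  by rewrite mul0n hj.
rewrite mulSn -addnA ltnNge leq_addr /= addKn IH // => s' hs'.
by apply: hs; right.
Qed.

(** * Bit sizes of the scaled data and the running time *)

Section Bounds.
Variables (m n : nat) (num den fin ub : nat -> nat).
Let K := size_data m n.
Let input := data_input m n num den fin ub.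
Let S := bitsize input.
Hypothesis den_gt0 : forall t, t < K -> 0 < den t.

Lemma bitsize_input : S = bitlen m + bitlen n +
  (\sum_(t < K) (bitlen (num t) + bitlen (den t))
   + \sum_(j < n) (bitlen (fin j) + bitlen (ub j))).
Proof.
have aux (f g : nat -> nat) k : bitsize (flatten [seq [:: f t; g t] | t <- iota 0 k]) =
   \sum_(t < k) (bitlen (f t) + bitlen (g t)).
  rewrite /bitsize big_flatten /= big_map.
  rewrite -(big_mkord predT (fun t => bitlen (f t) + bitlen (g t))) /index_iota subn0.
  by apply: eq_bigr => t _; rewrite !big_cons big_nil addn0.
rewrite /S /input /data_input -cat1s -[n :: _]cat1s !bitsize_cat !aux addnA.
by rewrite /bitsize !big_cons !big_nil !addn0.
Qed.

Lemma num_den_bits t : t < K -> bitlen (num t) + bitlen (den t) <= S.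
Proof. by move=> ht; rewrite bitsize_input (bigD1 (Ordinal ht)) //=; lia. Qed.

Lemma ub_bits j : j < n -> bitlen (ub j) <= S.
Proof. by move=> hj; rewrite bitsize_input [X in _ + (_ + X)](bigD1 (Ordinal hj)) //=; lia. Qed.

Lemma size_leq_bits : K + n + 2 <= S.
Proof.
rewrite bitsize_input.
have h1 : \sum_(t < K) 1 <= \sum_(t < K) (bitlen (num t) + bitlen (den t)).
  by apply: leq_sum.
have h2 : \sum_(j < n) 1 <= \sum_(j < n) (bitlen (fin j) + bitlen (ub j)).
  by apply: leq_sum.
rewrite !sum_nat_const !card_ord !muln1 in h1 h2.
by have := bitlen_gt0 m; have := bitlen_gt0 n; lia.
Qed.

Lemma scale_leq : scale m n den <= 2 ^ S.
Proof.
apply: (@leq_trans (\prod_(t < K) 2 ^ bitlen (den t))).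
  by apply: leq_prod => t _; apply: ltnW; exact: ltn_exp_bitlen.
rewrite -expn_sum leq_exp2l // bitsize_input big_split /=; lia.
Qed.

Lemma scaled_leq t : t < K -> scaled m n num den t <= 2 ^ (2 * S).
Proof.
move=> ht; apply: leq_trans (leq_div _ _) _.
rewrite mul2n -addnn expnD leq_mul ?scale_leq //.
apply: ltnW; rewrite -bitlen_leq; last by have := size_leq_bits; lia.
by have := num_den_bits ht; lia.
Qed.

Lemma big_leq : big m n num den <= 2 ^ (3 * S).
Proof.
apply: (@leq_trans (\sum_(t < K) 2 ^ (2 * S))); first by apply: leq_sum => t _; exact: scaled_leq.
rewrite sum_nat_const card_ord (_ : 3 * S = S + 2 * S) ?expnD; last by lia.
rewrite leq_mul2r; apply/orP; right; apply: leq_trans (ltnW (ltn_expl S (isT : 1 < 2))).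
by have := size_leq_bits; lia.
Qed.

Lemma cap_leq j : j < n -> cap m n num den fin ub j <= 2 ^ (3 * S).
Proof.
move=> hj; rewrite /cap; case: eqP => _; first exact: big_leq.
apply: ltnW; apply: leq_trans (ltn_exp_bitlen _) _; rewrite leq_exp2l //.
by have := ub_bits hj; lia.
Qed.

Lemma wcost_leq j : j < n -> wcost m n num den j <= 2 ^ (2 * S).
Proof.
move=> hj; rewrite /wcost; case: eqP => _; first by rewrite expn_gt0.
by apply: scaled_leq; apply: weight_index.
Qed.

Lemma cip_prog_run : exists y t,
  [/\ run (compile cip_prog) input (mkseq (level (wcost m n num den) y) n) t,
      t <= stm_cost (8 * S ^ 2) cip_prog * (8 * S ^ 2)
    & solved m n num den fin ub y].
Proof.
(* All values stay below [2 ^ w] already for [w] linear in [S]; the square is due to the rounds,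
   about n times a bit length of at most [2 * S + 1]. *)
have hS := size_leq_bits; set w := 8 * S ^ 2.
have hw : 5 * S < w by rewrite /w -mulnn; nia.
have pw e : e < w -> 2 ^ e < 2 ^ w by rewrite ltn_exp2l.
have w0 : 0 < w by lia.
have h := @cip_prog_spec m n num den fin ub w w0 _ den_gt0 _ _ _ _ _.
case: (wp_exec (h _ _ _ _ _ _)).
- by rewrite /w -mulnn -/K; nia.
- by apply: leq_ltn_trans scale_leq (pw _ _); lia.
- by apply: leq_ltn_trans big_leq (pw _ _); lia.
- move=> j hj; apply: (@leq_ltn_trans (2 ^ (2 * S + 3 * S))).
    by rewrite expnD leq_mul ?wcost_leq ?cap_leq.
  by apply: pw; lia.
- move=> j hj; apply: (@leq_ltn_trans (2 ^ (1 + 3 * S))).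
    by rewrite expnD expn1 mul2n -addnn leq_add ?big_leq ?cap_leq.
  by apply: pw; lia.
- move=> i hi.
  have : bitlen (rhs m n num den i) <= 2 * S + 1.
    rewrite bitlen_leq; last by lia.
    apply: leq_ltn_trans (scaled_leq _) _; first exact: rhs_index.
    by rewrite ltn_exp2l //; lia.
  by rewrite /w -mulnn; nia.
- split=> [a|]; first by rewrite expn_gt0.
  apply/allP => v /bitlen_leq_bitsize hv; rewrite -bitlen_leq //.
  by apply: leq_trans hv _; rewrite -/input -/S; lia.
move=> s [t [h1 h2 _ _ [y hy ho]]]; exists y, t; split=> //.
by exists s.
Qed.

End Bounds.

(** * Decoding an instance and transferring solutions *)

Section Instance.
Variables (m n : nat) (I : cip m n).

Definition data : seq rat :=
  [seq cip_A I i j | i <- enum 'I_m, j <- enum 'I_n]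
  ++ [seq cip_b I i 0%R | i <- enum 'I_m] ++ [seq cip_c I 0%R j | j <- enum 'I_n].

Definition bounds : seq (option nat) := [seq cip_d I j | j <- enum 'I_n].

Definition inst_num t := `|numq (nth 0%R data t)|%N.
Definition inst_den t := `|denq (nth 0%R data t)|%N.
Definition inst_fin j := if nth None bounds j is Some _ then 1 else 0.
Definition inst_ub j := odflt 0 (nth None bounds j).

Lemma size_dataE : size data = size_data m n.
Proof. by rewrite /data !size_cat size_allpairs !size_map -!enumT !size_enum_ord addnA. Qed.

Lemma encode_cipE : encode_cip I = data_input m n inst_num inst_den inst_fin inst_ub.
Proof.
rewrite /encode_cip /data_input cat_cons cat_cons /=; do 2 congr cons.
have -> : flatten [seq [:: inst_num t; inst_den t] | t <- iota 0 (size_data m n)] =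
    flatten (map encode_rat data).
  congr flatten; rewrite -[in RHS](mkseq_nth 0%R data) size_dataE /mkseq -map_comp.
  by apply: eq_map.
have -> : flatten [seq [:: inst_fin j; inst_ub j] | j <- iota 0 n] =
    flatten (map encode_bound bounds).
  have sz : size bounds = n by rewrite size_map size_enum_ord.
  congr flatten; rewrite -[in RHS](mkseq_nth None bounds) sz /mkseq -map_comp.
  apply: eq_map => j /=; rewrite /inst_fin /inst_ub.
  by case: (nth _ _ _).
by rewrite /data !map_cat !flatten_cat map_allpairs -!map_comp !catA.
Qed.

Lemma nth_data_A (i : 'I_m) (j : 'I_n) : nth 0%R data (i * n + j) = cip_A I i j.
Proof.
have lt : i * n + j < m * n by have := ltn_ord i; have := ltn_ord j; nia.
rewrite /data nth_cat size_allpairs !size_enum_ord lt.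
rewrite (@nth_flatten_uniform _ _ n) ?size_map -?enumT ?size_enum_ord //; last first.
  move=> s /List.in_map_iff[i0 [<- _]]; by rewrite size_map size_enum_ord.
rewrite (nth_map i) ?size_enum_ord // nth_ord_enum.
by rewrite (nth_map j) ?size_enum_ord // nth_ord_enum.
Qed.

Lemma nth_data_b (i : 'I_m) : nth 0%R data (m * n + i) = cip_b I i 0%R.
Proof.
rewrite /data nth_cat size_allpairs !size_enum_ord ltnNge leq_addr /= addKn.
rewrite nth_cat size_map size_enum_ord ltn_ord.
by rewrite (nth_map i) ?size_enum_ord // nth_ord_enum.
Qed.

Lemma nth_data_c (j : 'I_n) : nth 0%R data (m * n + m + j) = cip_c I 0%R j.
Proof.
rewrite /data nth_cat size_allpairs !size_enum_ord -addnA ltnNge leq_addr /= addKn.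
rewrite nth_cat size_map size_enum_ord ltnNge leq_addr /= addKn.
by rewrite (nth_map j) ?size_enum_ord // nth_ord_enum.
Qed.

Lemma nth_bounds (j : 'I_n) : nth None bounds j = cip_d I j.
Proof. by rewrite (nth_map j) ?size_enum_ord // nth_ord_enum. Qed.

Lemma inst_den_gt0 t : 0 < inst_den t.
Proof. by rewrite /inst_den absz_gt0 denq_neq0. Qed.

Notation G := (scale m n inst_den).
Notation coefI := (coef m n inst_num inst_den).
Notation rhsI := (rhs m n inst_num inst_den).
Notation weightI := (weight m n inst_num inst_den).
Notation wcostI := (wcost m n inst_num inst_den).
Notation capI := (cap m n inst_num inst_den inst_fin inst_ub).

Lemma scale_gt0 : 0 < G.
Proof. by rewrite prodn_gt0 // => t; apply: inst_den_gt0. Qed.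

(** The division in [scaled] is exact because every denominator divides the product [G]. *)
Lemma scaledE t : t < size_data m n -> (0 <= nth 0 data t)%R ->
  ((scaled m n inst_num inst_den t)%:R = nth 0 data t * G%:R :> rat)%R.
Proof.
move=> ht; set q := nth _ _ _ => q0.
have hd : inst_den t %| G by rewrite /scale (bigD1 (Ordinal ht)) //= dvdn_mulr.
have dn0 : ((inst_den t)%:R != 0 :> rat)%R by rewrite pnatr_eq0 -lt0n inst_den_gt0.
apply: (mulIf dn0); rewrite -natrM /scaled divnK ?dvdn_mull //.
rewrite natrM mulrAC; congr (_ * _)%R.
rewrite /inst_num /inst_den -/q !natr_absz !ger0_norm ?numq_ge0 ?denq_ge0 //.
by rewrite -{2}(divq_num_den q) mulfVK // intr_eq0 denq_neq0.
Qed.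

Lemma coefE (i : 'I_m) (j : 'I_n) : ((coefI i j)%:R = cip_A I i j * G%:R :> rat)%R.
Proof. by rewrite scaledE ?nth_data_A ?cip_A_ge0 // coef_index. Qed.

Lemma rhsE (i : 'I_m) : ((rhsI i)%:R = cip_b I i 0 * G%:R :> rat)%R.
Proof. by rewrite scaledE ?nth_data_b ?cip_b_ge0 // rhs_index. Qed.

Lemma weightE (j : 'I_n) : ((weightI j)%:R = cip_c I 0 j * G%:R :> rat)%R.
Proof. by rewrite scaledE ?nth_data_c ?cip_c_ge0 // weight_index. Qed.

Lemma coef_neq0 (i : 'I_m) (j : 'I_n) : (coefI i j != 0) = (cip_A I i j != 0%R).
Proof.
by rewrite -(pnatr_eq0 rat) coefE mulf_eq0 pnatr_eq0 (gtn_eqF scale_gt0) orbF.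
Qed.

Lemma cap_bounded (j : 'I_n) u : cip_d I j = Some u -> capI j = u.
Proof. by move=> h; rewrite /cap /inst_fin /inst_ub nth_bounds h. Qed.

Lemma cap_unbounded (j : 'I_n) : cip_d I j = None ->
  capI j = big m n inst_num inst_den.
Proof. by move=> h; rewrite /cap /inst_fin nth_bounds h. Qed.

Lemma natr_abszE (x : int) : (0 <= x)%R -> (`|x|%N%:R = x%:~R :> rat)%R.
Proof. by move=> x0; rewrite natr_absz ger0_norm. Qed.

Lemma row_scaled (x : 'cV[int]_n) (i : 'I_m) : (forall j, 0 <= x j 0)%R ->
  (cip_b I i 0 <= (cip_A I *m map_mx intr x) i 0)%R =
  (rhsI i <= \sum_(j < n) coefI i j * `|x j 0%R|%N).
Proof.
move=> x0; rewrite -(ler_nat rat) rhsE natr_sum mxE.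
have -> : (\sum_(j < n) (coefI i j * `|x j 0%R|%N)%N%:R =
   (\sum_(j < n) cip_A I i j * map_mx intr x j 0) * G%:R :> rat)%R.
  by rewrite mulr_suml; apply: eq_bigr => j _; rewrite natrM coefE natr_abszE // mxE mulrAC.
by rewrite ler_pM2r // ltr0n scale_gt0.
Qed.

Lemma objective_scaled (x : 'cV[int]_n) : (forall j, 0 <= x j 0)%R ->
  (objective I x * G%:R = (\sum_(j < n) weightI j * `|x j 0%R|%N)%:R)%R.
Proof.
move=> x0; rewrite /objective mxE natr_sum mulr_suml; apply: eq_bigr => j _.
by rewrite natrM weightE natr_abszE // mxE mulrAC.
Qed.

Lemma objective_leq k (x y : 'cV[int]_n) :
  (forall j, 0 <= x j 0)%R -> (forall j, 0 <= y j 0)%R ->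
  (objective I x <= k%:R * objective I y)%R =
  (\sum_(j < n) weightI j * `|x j 0%R|%N <= k * \sum_(j < n) weightI j * `|y j 0%R|%N).
Proof.
move=> x0 y0; rewrite -(ler_nat rat) natrM -!objective_scaled // mulrA.
by rewrite ler_pM2r // ltr0n scale_gt0.
Qed.

(** Objective values become natural numbers after scaling by [G], so the minimum is attained even
    over infinitely many solutions. *)
Lemma exists_optimal : (exists x, feasible I x) -> exists y, optimal I y.
Proof.
move=> h; have [x hx hmin] := exists_argmin
  (fun x : 'cV[int]_n => \sum_(j < n) weightI j * `|x j 0%R|%N) h.
exists x; split=> // y hy.
suff: (objective I x <= 1%:R * objective I y)%R by rewrite mul1r.
rewrite objective_leq ?mul1n ?hmin //.
- by case: hx.
- by case: hy.
Qed.

Definition capped (x : 'cV[int]_n) (j : nat) : nat :=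
  if insub j is Some o then minn `|x o 0%R|%N (capI j) else 0.

Lemma cappedE x (j : 'I_n) : capped x j = minn `|x j 0%R|%N (capI j).
Proof. by rewrite /capped valK. Qed.

(** Capping only cuts variables with an infinite bound. If a row contains a cut variable, its [big]
    units alone satisfy the row; otherwise the row sum is unchanged. *)
Lemma capped_feasible x : feasible I x ->
  scaled_feasible m n inst_num inst_den inst_fin inst_ub (capped x).
Proof.
case=> hrow x0 hd; split=> [i hi|j hj]; last first.
  by rewrite (cappedE x (Ordinal hj)) geq_minr.
have := hrow (Ordinal hi); rewrite row_scaled //= => h.
rewrite /row_feasible.
have [/existsP[j /andP[a0 hlt]]|] :=
  boolP [exists j : 'I_n, (coefI i j != 0) && (capI j < `|x j 0%R|)].
  have dj : cip_d I j = None.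
    case e : (cip_d I j) => [u|] //; have := hd j u e.
    by move: hlt; rewrite (cap_bounded e); have := x0 j; lia.
  apply: (@leq_trans (coefI i j * capped x j)).
    rewrite cappedE (minn_idPr (ltnW hlt)) (cap_unbounded dj).
    apply: (@leq_trans (big m n inst_num inst_den)).
      by apply: scaled_le_big; apply: rhs_index.
    by rewrite leq_pmull // lt0n.
  by rewrite (bigD1 j) //= leq_addr.
rewrite negb_exists => /forallP hn.
apply: leq_trans h _; apply: leq_sum => j _; have := hn j; rewrite negb_and negbK.
by case/orP=> [/eqP->//|]; rewrite -leqNgt cappedE => /minn_idPl->.
Qed.

Lemma solved_approx k y : row_sparse k (cip_A I) ->
  solved m n inst_num inst_den inst_fin inst_ub y ->
  (exists x, feasible I x) ->
  approx_solution k I (\col_j (level wcostI y j)%:Z)%R.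
Proof.
move=> hk [[hy0 hyc hpot] hres] hx; have [z hz] := exists_optimal hx.
have hzf := hz.1; have hzs := capped_feasible hzf.
set x := (\col_j _)%R.
have ex (j : 'I_n) : (x j 0 = (level wcostI y j)%:Z)%R by rewrite mxE.
have x0 j : (0 <= x j 0)%R by rewrite ex.
have z0 : (forall j, 0 <= z j 0)%R by case: hzf.
split.
  split=> // [i|j u hu].
    rewrite row_scaled //; have := hres _ hzs i (ltn_ord i).
    move/eqP; rewrite subn_eq0 => /leq_trans->//.
    by apply: leq_sum => j _; rewrite ex absz_nat.
  rewrite ex lez_nat -(cap_bounded hu) /level.
  rewrite (leq_trans (leq_div2r _ (hyc j (ltn_ord j)))) // mulKn //.
  exact: wcost_gt0.
exists z => //; rewrite objective_leq //.
have hk' i : i < m -> #|[set j : 'I_n | coefI i j != 0]| <= k.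
  move=> hi; apply: leq_trans (hk (Ordinal hi)).
  by rewrite (eq_card (B := [set j | cip_A I (Ordinal hi) j != 0%R])) // => j;
    rewrite !inE -(coef_neq0 (Ordinal hi)).
have h := hpot k _ hk' hzs.
(* A free variable costs nothing and its budget is at least [budget0]; any other variable costs at
   most its budget and starts from 0. *)
have h1 : \sum_(j < n) weightI j * `|x j 0%R|
    + \sum_(j < n) budget0 m n inst_num inst_den inst_fin inst_ub j <= \sum_(j < n) y j.
  rewrite -big_split leq_sum //= => j _; rewrite ex absz_nat.
  have := hy0 j (ltn_ord j); rewrite /budget0 /level /wcost.
  case: eqP => [->|_ _]; first by rewrite mul0n.
  by rewrite addn0 mulnC leq_divM.
(* The initial potential is at most the cost of [z]: free variables contribute 0, as their budgets
   start at the cap. *)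
have h2 : \sum_(j < n) (wcostI j * capped z j
      - budget0 m n inst_num inst_den inst_fin inst_ub j) <=
    \sum_(j < n) weightI j * `|z j 0%R|.
  apply: leq_sum => j _; rewrite cappedE /wcost /budget0; case: eqP => [->|_].
    by rewrite mul1n mul0n leqn0 subn_eq0 geq_minr.
  by rewrite subn0 leq_mul2l geq_minl orbT.
have h3 : k * \sum_(j < n) (wcostI j * capped z j
      - budget0 m n inst_num inst_den inst_fin inst_ub j) <=
    k * \sum_(j < n) weightI j * `|z j 0%R| by rewrite leq_mul2l h2 orbT.
apply: leq_trans h3.
(* The initial budgets are added on both sides, where [h1] and the amortised bound [h] cancel
   them. *)
rewrite -(leq_add2r (\sum_(j < n) budget0 m n inst_num inst_den inst_fin inst_ub j)).
apply: leq_trans h1 _; rewrite [X in _ <= X]addnC.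
by apply: leq_trans h; rewrite leq_addr.
Qed.

End Instance.

Theorem theorem1 :
  exists (P : cmd) (p : {poly nat}),
    forall (k m n : nat) (I : cip m n),
      row_sparse k (cip_A I) ->
      exists (output : seq nat) (t : nat),
        [/\ run P (encode_cip I) output t,
            (t <= p.[bitsize (encode_cip I)]%R)%N
          & (exists x : 'cV[int]_n, feasible I x) ->
            exists2 x : 'cV[int]_n,
              output = encode_sol x & approx_solution k I x].
Proof.
have [q hq] := stm_cost_poly cip_prog.
(* [r] evaluates to the value of [w] used for the run; the cost [stm_cost w * w] then becomes the
   polynomial [(q \Po r) * r]. *)
pose r : {poly nat} := (8%:P * ('X * 'X))%R.
have hr s : r.[s]%R = 8 * s ^ 2 by rewrite /r !hornerM hornerC hornerX -mulnn.
exists (compile cip_prog), ((q \Po r) * r)%R => k m n I hk.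
have [y [t [h1 h2 h3]]] := @cip_prog_run m n (inst_num I) (inst_den I)
  (inst_fin I) (inst_ub I) (fun t _ => inst_den_gt0 I t).
rewrite encode_cipE; exists (mkseq (level (wcost m n (inst_num I) (inst_den I)) y) n), t.
split=> //.
  by rewrite hornerM horner_comp hr hq.
move=> hx; exists (\col_j (level (wcost m n (inst_num I) (inst_den I)) y j)%:Z)%R.
  rewrite /encode_sol /mkseq -val_enum_ord -map_comp; apply: eq_map => j /=.
  by rewrite mxE absz_nat.
exact: solved_approx.
Qed.
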